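(* Suppose that the data $(\xi,f,S)$ satisfy the standing assumption stated in the context, and let $(Y^{\lambda},Z^{\lambda})$ be the unique solution of the penalized BSDE $$Y_t^{\lambda}=\xi+\int_t^{T}f_s(Y_s^{\lambda},Z_s^{\lambda})\,ds+\int_t^T\lambda\max\{0,S_s-Y^{\lambda}_s\}\,ds-\int_t^{T}Z_s^{\lambda}\,dW_s,\qquad t\in[0,T].$$ For any fixed $t\in[0,T]$, define the control set $$\mathcal{A}(t,\lambda)=\left\{\mathbb{F}\text{-adapted processes }(r_s)_{s\ge t}:\ r_s=0\text{ or }\lambda\right\}.$$ Then the value of the optimal control problem $$y_t^{\lambda}=\operatorname*{ess\,sup}_{r\in\mathcal{A}(t,\lambda)}\mathbf{E}\left[\int_t^{T}\big(f_s(Y_s^{\lambda},Z_s^{\lambda})+r_sS_s\big)e^{-\int_t^{s}r_u\,du}\,ds+e^{-\int_t^{T}r_u\,du}\,\xi\,\Big|\,\mathcal{F}_t\right]$$ is given by the solution of the penalized BSDE: $y_t^{\lambda}=Y_t^{\lambda}$ a.s. for $t\in[0,T]$. The optimal control is $r_s^{*}=\lambda\mathbf{1}_{\{Y_s^{\lambda}\le S_s\}}$ for $s\ge t$.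
   Context: Fix $T>0$ and $\lambda>0$. $W=(W_t)_{t\ge0}$ is a $d$-dimensional standard Brownian motion on a filtered probability space $(\Omega,\mathcal{F},\mathbb{F}=\{\mathcal{F}_t\}_{t\ge0},\mathbf{P})$ whose filtration $\mathbb{F}$ is right continuous and complete. Standing assumption on $(\xi,f,S)$: (i) the terminal datum $\xi$ ($\mathcal{F}_T$-measurable, real-valued) satisfies $\mathbf{E}[|\xi|^2]<\infty$; (ii) the driver $f:\Omega\times[0,T]\times\mathbb{R}\times\mathbb{R}^d\to\mathbb{R}$ is uniformly Lipschitz: $|f_t(y,z)-f_t(\bar y,\bar z)|\le C(|y-\bar y|+|z-\bar z|)$ a.s. for some $C>0$, with $f_t(0,0)$ $\mathbb{F}$-adapted and $\mathbf{E}[\int_0^T|f_t(0,0)|^2dt]<\infty$; (iii) the obstacle $S$ is a continuous $\mathbb{F}$-adapted real process with $\mathbf{E}[\sup_{t\in[0,T]}|S_t|^2]<\infty$. Under this assumption the penalized BSDE is taken to admit a unique $\mathbb{F}$-adapted square-integrable solution $(Y^\lambda,Z^\lambda)$, with $\mathbf{E}[\sup_{t\in[0,T]}|Y^\lambda_t|^2+\int_0^T|Z^\lambda_t|^2dt]<\infty$. *)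

(* Defs.v *)
From HB Require Import structures.
From mathcomp Require Import all_boot all_order all_algebra.
From mathcomp Require Import all_classical all_reals all_analysis.
From mathcomp Require Import measurable_realfun.

Set Implicit Arguments.
Unset Strict Implicit.
Unset Printing Implicit Defensive.

Import Order.TTheory GRing.Theory Num.Theory.
Import numFieldNormedType.Exports.

Local Open Scope classical_set_scope.
Local Open Scope ring_scope.

(* The norm that the library puts on ['rV_n] is the sup norm. *)
Definition eucl {R : rcfType} {n : nat} (z : 'rV[R]_n) : R :=
  Num.sqrt (\sum_(i < n) z 0 i ^+ 2).

Section stochastic_basis.
Context {d : measure_display} {Omega : measurableType d} {R : realType}.
Context (P : probability Omega R).

(* Measurability of a real random variable with respect to a sub-sigma-algebra
   given as a family of events. *)
Definition measurable_wrt (G : set (set Omega)) (X : Omega -> R) : Prop :=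
  forall B : set R, measurable B -> G (X @^-1` B).

(* Filtration indexed by [0, +oo[, right continuous and complete.  Since
   [F 0] consists of measurable sets, completeness of [F] makes [P] complete. *)
Definition usual_filtration (F : R -> set (set Omega)) : Prop :=
  [/\ forall t : R, 0 <= t -> sigma_algebra setT (F t) /\ F t `<=` measurable,
      forall s t : R, 0 <= s -> s <= t -> F s `<=` F t,
      forall t : R, 0 <= t -> F t = \bigcap_(s in [set s | t < s]) F s
    & forall N : set Omega, P.-negligible N -> F 0 N].

(* A process with time set [I] is jointly measurable in (time, outcome): this is
   what gives a meaning to its time integrals. *)
Definition measurable_process (I : set R) (X : R -> Omega -> R) : Prop :=
  measurable_fun (I `*` [set: Omega]) (fun p : R * Omega => X p.1 p.2).

Definition adapted_process (F : R -> set (set Omega)) (I : set R)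
    (X : R -> Omega -> R) : Prop :=
  measurable_process I X /\ forall t : R, I t -> measurable_wrt (F t) (X t).

Definition as_continuous (I : set R) (X : R -> Omega -> R) : Prop :=
  {ae P, forall w, {within I, continuous (fun t => X t w)}}.

(* The last clause says at once that [W t - W s] is independent of [F s] and
   that it is Gaussian with mean 0 and covariance matrix (t - s) * Id; the second
   parameter of [normal_prob] is the standard deviation. *)
Definition brownian_motion (n : nat) (F : R -> set (set Omega))
    (W : R -> Omega -> 'rV[R]_n) : Prop :=
  [/\ {ae P, forall w, W 0 w = 0},
      forall i, as_continuous `[0, +oo[ (fun t w => W t w 0 i),
      forall (t : R) i, 0 <= t -> measurable_wrt (F t) (fun w => W t w 0 i)
    & forall (s t : R) (A : set Omega) (B : 'I_n -> set R),
        0 <= s -> s < t -> F s A -> (forall i, measurable (B i)) ->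
        P (A `&` [set w | forall i, B i (W t w 0 i - W s w 0 i)]) =
        (P A * \prod_(i < n) normal_prob 0 (Num.sqrt (t - s)) (B i))%E].

(* [V] is a version of the conditional expectation of [X] given [G]. *)
Definition is_condE (G : set (set Omega)) (X V : Omega -> R) : Prop :=
  [/\ P.-integrable setT (EFin \o X),
      P.-integrable setT (EFin \o V),
      measurable_wrt G V
    & forall A, G A ->
        (\int[P]_(w in A) (V w)%:E = \int[P]_(w in A) (X w)%:E)%E].

Definition condE (G : set (set Omega)) (X : Omega -> R) : Omega -> R :=
  xget (cst 0) [set V | is_condE G X V].

(* Essential supremum of a family of random variables (as opposed to the
   essential supremum [ess_sup] of a single function): the a.s. least random
   variable that dominates a.s. each member of the family. *)
Definition is_ess_sup_family {I : Type} (A : set I) (X : I -> Omega -> \bar R)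
    (V : Omega -> \bar R) : Prop :=
  [/\ measurable_fun [set: Omega] V,
      forall i, A i -> {ae P, forall w, (X i w <= V w)%E}
    & forall V' : Omega -> \bar R, measurable_fun [set: Omega] V' ->
        (forall i, A i -> {ae P, forall w, (X i w <= V' w)%E}) ->
        {ae P, forall w, (V w <= V' w)%E}].

Definition ess_sup_family {I : Type} (A : set I) (X : I -> Omega -> \bar R) :
    Omega -> \bar R :=
  xget (cst 0%E) [set V | is_ess_sup_family A X V].

End stochastic_basis.

Section ito_integral.
Context {d : measure_display} {Omega : measurableType d} {R : realType}.
Context (P : probability Omega R) (F : R -> set (set Omega)) (n : nat).
Context (W : R -> Omega -> 'rV[R]_n).

(* Data of the simple process equal to [sp_val k] on ]sp_time k, sp_time k.+1]
   for k < sp_size. *)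
Record simple_process := SimpleProcess {
  sp_size : nat ;
  sp_time : nat -> R ;
  sp_val : nat -> Omega -> 'rV[R]_n }.

Definition is_simple (T : R) (h : simple_process) : Prop :=
  [/\ forall k, (k <= sp_size h)%N -> 0 <= sp_time h k <= T,
      forall k, (k < sp_size h)%N -> sp_time h k <= sp_time h k.+1,
      forall k i, (k < sp_size h)%N ->
        measurable_wrt (F (sp_time h k)) (fun w => sp_val h k w 0 i)
    & exists C : R, forall k w i, (k < sp_size h)%N ->
        `|sp_val h k w 0 i| <= C].

Definition simple_path (h : simple_process) (s : R) (w : Omega) : 'rV[R]_n :=
  \sum_(k < sp_size h)
    ((sp_time h k < s <= sp_time h k.+1)%R)%:R *: sp_val h k w.

Definition simple_integral (h : simple_process) (t : R) (w : Omega) : R :=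
  \sum_(k < sp_size h) \sum_(i < n) sp_val h k w 0 i *
    (W (Num.min (sp_time h k.+1) t) w 0 i - W (Num.min (sp_time h k) t) w 0 i).

(* [M] is a continuous version on [0, T] of the Ito integral
   t |-> \int_0^t Z_s dW_s: the L^2 limit of the integrals of simple processes
   that approximate [Z] in L^2(Omega * [0, T]). *)
Definition is_ito_integral (T : R) (Z : R -> Omega -> 'rV[R]_n)
    (M : R -> Omega -> R) : Prop :=
  [/\ forall t : R, 0 <= t <= T -> measurable_wrt (F t) (M t),
      as_continuous P `[0, T] M
    & exists h : nat -> simple_process,
      [/\ forall m, is_simple T (h m),
          (fun m => \int[P]_w \int[lebesgue_measure]_(s in `[0%R, T])
             ((eucl (Z s w - simple_path (h m) s w) ^+ 2)%:E))%E @ \oo --> 0%E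
        & forall t : R, 0 <= t <= T ->
          (fun m => \int[P]_w
             (((simple_integral (h m) t w - M t w) ^+ 2)%:E))%E @ \oo --> 0%E]].

End ito_integral.

Section penalized_bsde.
Context {d : measure_display} {Omega : measurableType d} {R : realType}.
Context (P : probability Omega R) (F : R -> set (set Omega)) (n : nat).
Context (W : R -> Omega -> 'rV[R]_n) (T lambda : R).
Context (xi : Omega -> R) (f : R -> Omega -> R -> 'rV[R]_n -> R).
Context (S : R -> Omega -> R).

Notation mu := lebesgue_measure.

Definition terminal_assumption : Prop :=
  measurable_wrt (F T) xi /\ (\int[P]_w ((xi w ^+ 2)%:E) < +oo)%E.

Definition driver_assumption : Prop :=
  [/\ forall y z, measurable_process `[0, T] (fun t w => f t w y z),
      exists2 C : R, 0 < C &
        {ae P, forall w, forall t : R, 0 <= t <= T -> forall y y' z z',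
          `|f t w y z - f t w y' z'| <= C * (`|y - y'| + eucl (z - z'))},
      adapted_process F `[0, T] (fun t w => f t w 0 0)
    & (\int[P]_w \int[mu]_(t in `[0%R, T]) (`|f t w 0 0| ^+ 2)%:E < +oo)%E].

Definition obstacle_assumption : Prop :=
  [/\ as_continuous P `[0, T] S,
      adapted_process F `[0, T] S
    & (\int[P]_w ereal_sup [set (`|S t w| ^+ 2)%:E | t in `[0%R, T]]
        < +oo)%E].

Definition standing_assumption : Prop :=
  [/\ terminal_assumption, driver_assumption & obstacle_assumption].

(* In the equation, \int_t^T Z_s dW_s is the increment [M T w - M t w] of the
   Ito integral [M] of [Z]. *)
Definition is_penalized_bsde_solution (Y : R -> Omega -> R)
    (Z : R -> Omega -> 'rV[R]_n) : Prop :=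
  [/\ adapted_process F `[0, T] Y,
      forall i, adapted_process F `[0, T] (fun t w => Z t w 0 i),
      (\int[P]_w (ereal_sup [set (`|Y t w| ^+ 2)%:E | t in `[0%R, T]]
          + \int[mu]_(t in `[0%R, T]) (eucl (Z t w) ^+ 2)%:E) < +oo)%E
    & exists2 M : R -> Omega -> R, is_ito_integral P F W T Z M &
        {ae P, forall w, forall t : R, 0 <= t <= T ->
          Y t w = xi w
            + \int[mu]_(s in `[t, T]) f s w (Y s w) (Z s w)
            + \int[mu]_(s in `[t, T]) (lambda * Num.max 0 (S s w - Y s w))
            - (M T w - M t w)}].

Definition controls (t : R) : set (R -> Omega -> R) :=
  [set r | adapted_process F `[t, +oo[ r /\
           forall (s : R) (w : Omega), t <= s -> r s w = 0 \/ r s w = lambda].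

Context (Y : R -> Omega -> R) (Z : R -> Omega -> 'rV[R]_n).

Definition payoff (t : R) (r : R -> Omega -> R) (w : Omega) : R :=
  \int[mu]_(s in `[t, T])
     ((f s w (Y s w) (Z s w) + r s w * S s w)
        * expR (- \int[mu]_(u in `[t, s]) r u w))
  + expR (- \int[mu]_(u in `[t, T]) r u w) * xi w.

Definition conditional_payoff (t : R) (r : R -> Omega -> R) : Omega -> \bar R :=
  EFin \o condE P (F t) (payoff t r).

Definition value (t : R) : Omega -> \bar R :=
  ess_sup_family P (controls t) (conditional_payoff t).

Definition is_optimal (t : R) (r : R -> Omega -> R) : Prop :=
  controls t r /\ {ae P, forall w, conditional_payoff t r w = value t w}.

(* [Y] and [S] are only defined up to time [T], and [payoff] does not look at
   the control after [T], where it is set to 0. *)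
Definition optimal_control (s : R) (w : Omega) : R :=
  lambda * ((s <= T) && (Y s w <= S s w))%:R.

End penalized_bsde.

(* Main.v *)
(* Put [g = f(Y,Z) + lambda (S - Y)^+] and [D_s = xi - Y_s + int_s^T g].  By the
   BSDE [D_s = M_T - M_s], where [M] is an L^2 limit of simple stochastic
   integrals, so [E[D_s | F_s] = 0].  For a control [r] let [I_s = int_t^s r] and
   [rho_s = r_s exp(-I_s)], so that [int_t^s rho = 1 - exp(-I_s)].  Exchanging
   the order of integration on each path gives
     payoff(r) = Y_t + (D_t - int_t^T rho_s D_s ds)
                 + int_t^T exp(-I_s) (r_s (S_s - Y_s) - lambda (S_s - Y_s)^+) ds.
   The middle term has zero conditional expectation given F_t, because [rho_s]
   is determined by F_s and [E[D_s | F_s] = 0]; the last one is nonpositive for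
   every control and vanishes for [r^*].  No Ito formula is needed. *)
From HB Require Import structures.
Require Import Defs.
From mathcomp Require Import all_boot all_order all_algebra.
From mathcomp Require Import all_classical all_reals all_analysis.
From mathcomp Require Import measurable_realfun.
From mathcomp Require Import ring lra.
Import Order.TTheory GRing.Theory Num.Theory.
Import numFieldNormedType.Exports.
Local Open Scope classical_set_scope.
Local Open Scope ring_scope.

Set Implicit Arguments.
Unset Strict Implicit.

(** * Random variables with zero conditional expectation *)

(** That [rho_s] is determined by [F_s] hides the main obstacle: a control is adapted and jointly
    measurable, but not assumed progressively measurable, so the [F_s]-measurability of [I_s] is not
    at hand. Only the single variables [r_u], [u <= s], are known to be [F_s]-measurable. This is
    why [E[X | G] = 0] is expressed through the integrals of [X] over the events of [G]: Fubini
    carries this property to [X] times a path integral, and powers and the exponential series lead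
    from there to [exp(-I_s)]. Another obstacle is that the Lipschitz bound, the equation and the
    integrability of paths hold only almost surely. The processes are therefore replaced by [0] on
    one null set and outside [[t, T]], which makes the path identities valid for every outcome;
    completeness of [P] leads back to the payoff itself. Conditional expectations and essential
    suprema are chosen by [xget], so their existence has to be established: by Radon-Nikodym for the
    former, by exhibiting [Y t] for the latter. *)

Section integrable_real.
Context {R : realType}.

Lemma integral_indicM d' (T : measurableType d') (m : {measure set T -> \bar R})
    (A : set T) (X : T -> R) :
  (\int[m]_(w in A) (X w)%:E = \int[m]_w (X w * \1_A w)%:E)%E.
Proof.
rewrite integral_mkcond; apply: eq_integral => w _.
rewrite patchE indicE; case: ifPn => _; by rewrite ?mulr1 ?mulr0.
Qed.

Lemma integrable_fubini_G d1 d2 (T1 : measurableType d1) (T2 : measurableType d2)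
    (m1 : {sigma_finite_measure set T1 -> \bar R})
    (m2 : {sigma_finite_measure set T2 -> \bar R}) (f : T1 * T2 -> \bar R) :
  (m1 \x m2)%E.-integrable setT f -> m2.-integrable setT (fubini_G m1 f).
Proof.
move=> fi; have mf := measurable_int _ fi.
have maf : measurable_fun setT (abse \o f) by exact: measurableT_comp.
have := (integrable21ltyP m1 m2 mf).1 fi => fo.
apply/integrableP; split; first exact: measurable_fubini_G fi.
apply: le_lt_trans fo; apply: ge0_le_integral => //.
- by apply: measurableT_comp => //; exact: measurable_fubini_G fi.
- by apply: (measurable_fun_fubini_tonelli_G (abse \o f)) => //= x.
- move=> y _; apply: le_abse_integral => //.
  exact: (measurableT_comp mf).
Qed.

Section domain.
Context d' (T : measurableType d') (m : {measure set T -> \bar R}).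
Variables (D : set T) (mD : measurable D).
Implicit Types f g : T -> R.

Lemma integrable_addr f g : m.-integrable D (EFin \o f) ->
  m.-integrable D (EFin \o g) -> m.-integrable D (fun w => (f w + g w)%:E).
Proof. by move=> fi gi; exact: (integrableD mD fi gi). Qed.

Lemma integrable_subr f g : m.-integrable D (EFin \o f) ->
  m.-integrable D (EFin \o g) -> m.-integrable D (fun w => (f w - g w)%:E).
Proof. by move=> fi gi; exact: (integrableB mD fi gi). Qed.

Lemma integrable_scaler k f : m.-integrable D (EFin \o f) ->
  m.-integrable D (fun w => (k * f w)%:E).
Proof. by move=> fi; exact: (integrableZl mD k fi). Qed.

Lemma integrable_normr f : m.-integrable D (EFin \o f) ->
  m.-integrable D (fun w => `|f w|%:E).
Proof. by move=> fi; exact: (integrable_abse fi). Qed.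

Lemma integrable_ler f g : measurable_fun D f ->
  (forall w, D w -> `|f w| <= g w) ->
  m.-integrable D (EFin \o g) -> m.-integrable D (EFin \o f).
Proof.
move=> mf fg; apply: le_integrable => //; first exact/measurable_EFinP.
by move=> w Dw /=; rewrite lee_fin (le_trans (fg _ Dw))// ler_norm.
Qed.

Lemma integrable_measr f : m.-integrable D (EFin \o f) -> measurable_fun D f.
Proof. by move=> fi; apply/measurable_EFinP; exact: measurable_int fi. Qed.

End domain.

End integrable_real.

Section orth.
Context {d : measure_display} {Omega : measurableType d} {R : realType}.
Variable P : probability Omega R.
Notation mu := (@lebesgue_measure R).
Implicit Types (G : set (set Omega)) (X : Omega -> R).

(* [E(X | G) = 0], expressed without choosing a version of the conditional
   expectation. *)
Definition orth G X := P.-integrable setT (EFin \o X) /\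
  forall A, G A -> (\int[P]_(w in A) (X w)%:E = 0)%E.

Variable G : set (set Omega).
Hypothesis GM : G `<=` measurable.

Lemma orthD X1 X2 : orth G X1 -> orth G X2 -> orth G (fun w => X1 w + X2 w).
Proof.
move=> [i1 o1] [i2 o2]; split; first exact: (integrableD measurableT i1 i2).
move=> A GA; have mA := GM GA.
under eq_integral do rewrite EFinD.
rewrite integralD//; first by rewrite o1// o2// adde0.
- exact: (integrableS measurableT _ _ i1).
- exact: (integrableS measurableT _ _ i2).
Qed.

Lemma orthZ k X : orth G X -> orth G (fun w => k * X w).
Proof.
move=> [i1 o1]; split; first exact: (integrableZl measurableT k i1).
move=> A GA; have mA := GM GA.
under eq_integral do rewrite EFinM.
rewrite integralZl//; first by rewrite o1// mule0.
exact: (integrableS measurableT _ _ i1).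
Qed.

(** [fine] sends an infinite inner integral to [0], so the real integral is dominated everywhere by
    the extended one, which Fubini makes integrable. *)
Lemma integrable_Rintegral_fst (H : R * Omega -> R) :
  (mu \x P)%E.-integrable setT (EFin \o H) ->
  P.-integrable setT (EFin \o (fun w => \int[mu]_u H (u, w))).
Proof.
move=> iH.
have mI := measurable_fubini_G iH.
have iI := integrable_fubini_G iH.
have mR : measurable_fun setT (fun w => (\int[mu]_u H (u, w))%:E).
  by apply/measurable_EFinP; exact: (measurableT_comp (fine_measurable measurableT) mI).
apply: (le_integrable measurableT mR _ iI) => w _ /=.
rewrite /Rintegral /fubini_G /=; case: (integral _ _ _) => [r||] //=.
  by rewrite normr0 leey.
by rewrite normr0 leey.
Qed.

(** Fubini, applied to [H] times the indicator of [A], puts the integral over [Omega] inside, where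
    it vanishes for each [u]. The real and extended inner integrals differ only on a null set. *)
Lemma orth_int (H : R * Omega -> R) :
  (mu \x P)%E.-integrable setT (EFin \o H) ->
  (forall u A, G A -> (\int[P]_(w in A) (H (u, w))%:E = 0)%E) ->
  orth G (fun w => \int[mu]_u H (u, w)).
Proof.
move=> iH oH.
have mI := measurable_fubini_G iH.
have iI := integrable_fubini_G iH.
have mH : measurable_fun setT H.
  by apply/measurable_EFinP; exact: (measurable_int _ iH).
have iR := integrable_Rintegral_fst iH.
split => //.
move=> A GA; have mA := GM GA.
transitivity (\int[P]_(w in A) \int[mu]_u (H (u, w))%:E)%E.
  apply: ae_eq_integral => //.
  - by apply: measurable_funTS; exact: measurable_int iR.
  - exact: measurable_funTS.
  - have := integrable_ae measurableT iI.
    apply: filterS => w /= /(_ I) h _; rewrite /Rintegral fineK//.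
rewrite integral_mkcond.
transitivity (\int[P]_w \int[mu]_u (H (u, w) * \1_A w)%:E)%E.
  apply: eq_integral => w _; rewrite patchE indicE; case: ifPn => _.
    by under [RHS]eq_integral do rewrite mulr1.
  by under eq_integral do rewrite mulr0; rewrite integral0.
have := @Fubini _ _ _ _ _ mu P (fun p => (H p * \1_A p.2)%:E).
move=> /= <-.
- rewrite integral0_eq// => u _.
  by rewrite -(integral_indicM P A (fun w => H (u, w))) oH.
- apply: (le_integrable measurableT _ _ iH).
    apply/measurable_EFinP; apply: measurable_funM => //.
    by apply: (measurableT_comp _ (@measurable_snd _ _ _ _)); exact: measurable_indic.
  move=> p _ /=; rewrite lee_fin normrM ler_piMr// indicE.
  by case: (_ \in _); rewrite ?normr1 ?normr0.
Qed.

Hypothesis Gsa : sigma_algebra setT G.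

Lemma sa_setI A B : G A -> G B -> G (A `&` B).
Proof.
by rewrite -(sigma_algebra_id Gsa); exact: (@measurableI _ (g_sigma_algebraType G)). Qed.

(** Integrating [X * \1_B] over [A] is integrating [X] over the intersection of [A] and [B], again
    an event of [G]. *)
Lemma orth_indic X B : orth G X -> G B -> orth G (fun w => X w * \1_B w).
Proof.
move=> [iX oX] GB; have mB := GM GB; split.
  apply: (le_integrable measurableT _ _ iX).
    apply/measurable_EFinP; apply: measurable_funM => //.
    by apply/measurable_EFinP; exact: (measurable_int _ iX).
  move=> p _ /=; rewrite lee_fin normrM ler_piMr// indicE.
  by case: (_ \in _); rewrite ?normr1 ?normr0.
move=> A GA.
transitivity (\int[P]_(w in A `&` B) (X w)%:E)%E.
  rewrite [in RHS]integral_indicM integral_indicM; apply: eq_integral => w _.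
  by rewrite indicI /= [\1_A w * _]mulrC mulrA.
exact/oX/sa_setI.
Qed.

Lemma orth_eq X X' : X =1 X' -> orth G X -> orth G X'.
Proof. by move=> /funext ->. Qed.

Lemma orth_cst0 : orth G (fun=> 0).
Proof. by split=> [|A _]; [exact: integrable0|rewrite integral0]. Qed.

End orth.

(** Tonelli factors the integral of the absolute value into the product of the two L^1 norms. *)
Lemma integrable_prodM (R : realType) d1 d2 (T1 : measurableType d1) (T2 : measurableType d2)
    (m1 : {sigma_finite_measure set T1 -> \bar R})
    (m2 : {sigma_finite_measure set T2 -> \bar R}) (f : T1 -> R) (g : T2 -> R) :
  m1.-integrable setT (EFin \o f) -> m2.-integrable setT (EFin \o g) ->
  (m1 \x m2)%E.-integrable setT (fun p => (f p.1 * g p.2)%:E).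
Proof.
move=> fi gi; apply/integrable12ltyP.
  apply/measurable_EFinP; apply: measurable_funM.
    apply: (measurableT_comp _ measurable_fst).
    by apply/measurable_EFinP; exact: measurable_int fi.
  apply: (measurableT_comp _ measurable_snd).
  by apply/measurable_EFinP; exact: measurable_int gi.
under eq_integral => x _.
  under eq_integral => y _ do rewrite /= normrM EFinM.
  rewrite integralZl//; last exact: (integrable_abse gi).
  over.
have /integrableP[mg goo] := gi; have /integrableP[mf foo] := fi.
have gfin : (\int[m2]_y `|g y|%:E)%E \is a fin_num.
  by rewrite ge0_fin_numE//; exact: integral_ge0.
rewrite -(fineK gfin) ge0_integralZr//=.
- have ffin : (\int[m1]_x `|f x|%:E)%E \is a fin_num.
    by rewrite ge0_fin_numE//; exact: integral_ge0.
  by rewrite -(fineK ffin) -EFinM ltry.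
- by apply: (measurableT_comp (@abse_measurable R setT) mf).
- by rewrite lee_fin fine_ge0//; exact: integral_ge0.
Qed.

(** * Zero conditional expectation after multiplication by a path integral or its exponential *)

Section orth_exp.
Context {d : measure_display} {Omega : measurableType d} {R : realType}.
Variable P : probability Omega R.
Notation mu := (@lebesgue_measure R).

Variable G : set (set Omega).
Hypotheses (GM : G `<=` measurable) (Gsa : sigma_algebra setT G).

(** [K] will be the control cut at a time [s], with [c = lambda], and also, with [c = 1], the
    indicator in a layer-cake formula. *)
Variables (a b c : R) (K : R * Omega -> R).
Hypotheses (ab : a <= b) (c0 : 0 <= c).
Hypotheses (mK : measurable_fun setT K).
Hypothesis K0c : forall u w, K (u, w) = 0 \/ K (u, w) = c.
Hypothesis Kout : forall u w, ~~ (a <= u <= b) -> K (u, w) = 0.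
Hypothesis KG : forall u, G [set w | K (u, w) = c].

Let KE u w : K (u, w) = c * \1_[set w | K (u, w) = c] w.
Proof.
rewrite indicE; case: (boolP (w \in _)); rewrite ?inE/=; first by move=> ->; rewrite mulr1.
by rewrite notin_setE /= mulr0; case: (K0c u w).
Qed.

Let K_bound u w : 0 <= K (u, w) <= c * \1_(`[a, b]%classic) u.
Proof.
rewrite indicE mem_setE in_itv/=; have [h|h] := boolP (a <= u <= b).
  by rewrite mulr1; case: (K0c u w) => ->; rewrite lexx ?c0.
by rewrite Kout//= mulr0 lexx.
Qed.

Let iab : mu.-integrable setT (EFin \o (fun u => c * \1_(`[a, b]%classic) u)).
Proof.
exact: (integrableZl measurableT c (integrable_indic_itv a b true false)).
Qed.

Let Kint w : mu.-integrable setT (EFin \o (fun u => K (u, w))).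
Proof.
apply: (le_integrable measurableT _ _ iab).
  by apply/measurable_EFinP; exact: (measurable_fun_pair1 w mK).
move=> u _ /=; rewrite lee_fin; have /andP[k0 k1] := K_bound u w.
by rewrite !ger0_norm// (le_trans k0).
Qed.

(* Fubini makes the G-measurability of the path integral of [K] unnecessary:
   only the sections [K (u, _)] have to be G-measurable.  The powers and the
   exponential of this integral below are reached by iteration and by the
   exponential series. *)
Lemma orth_mulint X : orth P G X -> orth P G (fun w => X w * \int[mu]_u K (u, w)).
Proof.
move=> [iX oX].
apply: (@orth_eq _ _ _ _ _ (fun w => \int[mu]_u (X w * K (u, w)))).
  by move=> w; rewrite RintegralZl//; exact: Kint.
have mX : measurable_fun setT X by apply/measurable_EFinP; exact: measurable_int iX.
apply: (@orth_int _ _ _ _ _ GM (fun p => X p.2 * K p)) => [|u A GA].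
  apply: (le_integrable measurableT _ _ (integrable_prodM iab iX)).
    apply/measurable_EFinP; apply: measurable_funM => //.
    exact: (measurableT_comp mX measurable_snd).
  move=> [u w] _ /=; rewrite lee_fin; have /andP[k0 k1] := K_bound u w.
  by rewrite [leLHS]normrM [leRHS]normrM mulrC ler_wpM2r// !ger0_norm// (le_trans k0).
have [_ /(_ A GA)] := orthZ GM c (orth_indic GM Gsa (conj iX oX) (KG u)).
move=> <-; apply: eq_integral => w _ /=.
by rewrite KE mulrCA.
Qed.

Let I w := \int[mu]_u K (u, w).

Lemma orth_mulint_exp k X : orth P G X -> orth P G (fun w => X w * I w ^+ k).
Proof.
move=> oX; elim: k => [|k IH].
  by apply: orth_eq oX => w; rewrite expr0 mulr1.
by apply: orth_eq (orth_mulint IH) => w; rewrite exprSr mulrA.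
Qed.

Let I_bound w : 0 <= I w <= c * (b - a).
Proof.
apply/andP; split.
  by apply: Rintegral_ge0 => u _; case/andP: (K_bound u w).
have := le_Rintegral measurableT (Kint w) iab.
move=> /(_ (fun u _ => (andP (K_bound u w)).2)) /le_trans; apply.
rewrite RintegralZl//; last exact: (integrable_indic_itv a b true false).
rewrite /Rintegral integral_indic//= setIT lebesgue_measure_itv/= lte_fin.
by case: ltP => h //=; rewrite (@le_anti _ _ a b) ?ab ?h// subrr.
Qed.

(** Since [0 <= I <= c (b - a)], the partial sums of the exponential series at [- I], times [X], are
    dominated by [exp (c (b - a)) |X|]; dominated convergence carries the vanishing integrals to the
    limit. *)
Lemma orth_mulexpN X : orth P G X -> orth P G (fun w => X w * expR (- I w)).
Proof.
move=> oX; have [iX _] := oX.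
have mX : measurable_fun setT X by apply/measurable_EFinP; exact: measurable_int iX.
pose S m w := X w * series (exp_coeff (- I w)) m.
have oS m : orth P G (S m).
  elim: m => [|m IH].
    apply: orth_eq (orth_cst0 P G) => w.
    by rewrite /S /series /= big_geq// mulr0.
  have := orthD GM IH (orthZ GM ((-1) ^+ m / m`!%:R) (orth_mulint_exp m oX)).
  apply: orth_eq => w; rewrite /S /series /= big_nat_recr//= /exp_coeff /=.
  rewrite [(- I w) ^+ m]exprNn; ring.
have SX w : (S ^~ w @ \oo --> X w * expR (- I w)).
  apply: cvgMr; exact: is_cvg_series_exp_coeff.
have mS m : measurable_fun setT (S m).
  by apply/measurable_EFinP; exact: (measurable_int _ (oS m).1).
have mE : measurable_fun setT (fun w => X w * expR (- I w)).
  apply: measurable_fun_cvg => [m|w _]; [exact: mS|exact: SX].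
have bS w m : `|S m w| <= expR (c * (b - a)) * `|X w|.
  rewrite normrM mulrC ler_wpM2r//.
  apply: (@le_trans _ _ (series (exp_coeff `|I w|) m)).
    rewrite -[`|I w|]normrN -normed_series_exp_coeff /series/=; exact: ler_norm_sum.
  have /andP[i0 i1] := I_bound w; rewrite ger0_norm//.
  apply: (@le_trans _ _ (expR (I w))); last by rewrite ler_expR.
  apply: nondecreasing_cvgn_le; last exact: is_cvg_series_exp_coeff.
  apply/nondecreasing_seqP => k; rewrite /series/= big_nat_recr//= lerDl.
  exact: exp_coeff_ge0.
have ig : P.-integrable setT (fun w => (expR (c * (b - a)) * `|X w|)%:E).
  exact: (integrableZl measurableT _ (integrable_abse iX)).
have iE : P.-integrable setT (EFin \o (fun w => X w * expR (- I w))).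
  apply: (le_integrable measurableT _ _ iX); first exact/measurable_EFinP.
  move=> w _ /=; rewrite lee_fin normrM ler_piMr// ger0_norm ?expR_ge0//.
  by rewrite expR_le1 oppr_le0; case/andP: (I_bound w).
split => // A GA; have mA := GM GA.
have dc := @dominated_convergence _ _ _ P A mA
  (fun m w => (S m w)%:E) (fun w => (X w * expR (- I w))%:E)
  (fun w => (expR (c * (b - a)) * `|X w|)%:E).
have [|||||_ _] := dc.
- by move=> m; apply/measurable_funTS/measurable_EFinP.
- by apply/measurable_funTS/measurable_EFinP.
- by apply: aeW => w _; apply: cvg_EFin; [exact: nearW|exact: SX].
- exact: (integrableS measurableT _ _ ig).
- by apply: aeW => w m _; rewrite lee_fin.
rewrite (_ : (fun m => _) = cst 0%E); last first.
  by apply/funext => m; exact: (oS m).2.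
by move/(cvg_unique _ (cvg_cst _)) => <-.
Qed.

End orth_exp.

(** * Conditional expectations *)

Section condE.
Context {d : measure_display} {Omega : measurableType d} {R : realType}.
Variable P : probability Omega R.

Variable G : set (set Omega).
Hypotheses (GM : G `<=` measurable) (Gsa : sigma_algebra setT G).

Lemma measurable_wrtP (X : Omega -> R) :
  measurable_wrt G X <-> measurable_fun [set: g_sigma_algebraType G] X.
Proof.
split=> mX.
  by move=> _ B mB; rewrite setTI; apply: sub_sigma_algebra; exact: mX.
move=> B mB; rewrite -(sigma_algebra_id Gsa) -[X in <<s _ >> X]setTI.
exact: mX.
Qed.

Lemma measurable_wrt_measurable (X : Omega -> R) :
  measurable_wrt G X -> measurable_fun setT X.
Proof. by move=> mX _ B mB; rewrite setTI; apply/GM/mX. Qed.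

(** Tested on the event [V' < V] of [G], the hypothesis forces the integral of the positive function
    [V - V'] there to vanish, so the event is null. *)
Lemma condE_le_ae (V V' : Omega -> R) :
  measurable_wrt G V -> measurable_wrt G V' ->
  P.-integrable setT (EFin \o V) -> P.-integrable setT (EFin \o V') ->
  (forall A, G A ->
    (\int[P]_(w in A) (V w)%:E <= \int[P]_(w in A) (V' w)%:E)%E) ->
  {ae P, forall w, V w <= V' w}.
Proof.
move=> mV mV' iV iV' VV'.
pose A := [set w | V' w < V w].
have GA : G A.
  rewrite -(sigma_algebra_id Gsa).
  have := measurable_fun_ltr ((measurable_wrtP _).1 mV') ((measurable_wrtP _).1 mV).
  move=> /(_ measurableT [set true] I); rewrite setTI.
  by congr (_ _); apply/seteqP; split => w /=.
have mA := GM GA.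
have iVA := integrableS measurableT mA (@subsetT _ _) iV.
have iVA' := integrableS measurableT mA (@subsetT _ _) iV'.
have mW : measurable_fun A (fun w => (V w - V' w)%:E).
  apply/measurable_EFinP/measurable_funTS/measurable_funB; exact: measurable_wrt_measurable.
have A0 : (\int[P]_(w in A) `|(V w - V' w)%:E| = 0)%E.
  apply/eqP; rewrite eq_le integral_ge0// andbT.
  have -> : (\int[P]_(w in A) `|(V w - V' w)%:E| = \int[P]_(w in A) ((V w)%:E - (V' w)%:E))%E.
    apply: eq_integral => w; rewrite inE /A /= => wA.
    by rewrite ger0_norm// subr_ge0 ltW.
  rewrite integralB_EFin// sube_le0//; exact: VV'.
have [N [mN N0 AN]] := (ae_eq_integral_abs P mA mW).1 A0.
exists N; split => // w /= /negP; rewrite -ltNge => wA; apply: AN => /= /(_ wA).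
by move=> [] /eqP; rewrite subr_eq0 gt_eqF.
Qed.

(** Radon-Nikodym on [G]: the charge [A |-> int_A X] and [P] are both restricted to [G] by pushing
    them forward along the identity, and the density is a conditional expectation. *)
Lemma condE_exists (X : Omega -> R) : P.-integrable setT (EFin \o X) ->
  exists V, is_condE P G X V.
Proof.
move=> iX.
have sub (B : set Omega) : <<s G >> B -> measurable B.
  by rewrite (sigma_algebra_id Gsa) => /GM.
pose T' := g_sigma_algebraType G.
pose phi : Omega -> T' := id.
have mphi : measurable_fun setT phi.
  move=> _ B; rewrite setTI /phi preimage_id => mB; exact: sub.
pose phi' : {mfun Omega >-> T'} := HB.pack phi (isMeasurableFun.Build _ _ _ _ phi mphi).
pose nu0 : {charge set T' -> \bar R} := pushforward (induced_charge iX) phi'.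
pose nu := nu0 mphi.
pose m : probability T' R := distribution P phi'.
have num : nu `<< m.
  apply/null_content_dominatesP => A mA mA0.
  apply: null_set_integral => //.
  - exact: sub.
  - apply: measurable_funTS; exact: measurable_int iX.
pose V := fine \o Radon_Nikodym nu m.
have iRN := Radon_Nikodym_integrable num.
have mV : measurable_fun [set: T'] V.
  apply: (measurableT_comp (fine_measurable measurableT)); exact: measurable_int iRN.
have VE w : (V w)%:E = Radon_Nikodym nu m w by rewrite /V/= fineK// Radon_Nikodym_fin_num.
have wV : measurable_wrt G V by apply/measurable_wrtP.
have iV : P.-integrable setT (EFin \o V).
  apply/integrableP; split.
    exact/measurable_EFinP/measurable_wrt_measurable.
  have /integrableP[mRN] := iRN.
  rewrite ge0_integral_distribution//=; last exact: measurableT_comp.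
  by under eq_integral do rewrite -VE.
exists V; split => // A GA.
have mA : measurable (A : set T') by exact: sub_sigma_algebra.
transitivity (\int[m]_(w in A) (V w)%:E)%E.
  rewrite /m /distribution (@integral_pushforward _ _ _ _ _ _ mphi P A (EFin \o V))//.
  - exact/measurable_EFinP.
  - by apply: (integrableS measurableT _ _ iV); first exact: GM.
transitivity (nu A); last by [].
rewrite (Radon_Nikodym_integral num mA).
by apply: eq_integral => w _; rewrite VE.
Qed.
End condE.

(** * Brownian increments and stochastic integrals *)

Section normal_mean.
Context {R : realType}.
Notation mu := (@lebesgue_measure R).
Variables (s : R) (s0 : 0 < s).

Let nu : probability (measurableTypeR R) R := @normal_prob R 0 s.

(** The density is even and Lebesgue measure is invariant under reflection. *)
Lemma normal_prob_opp (A : set R) : measurable A ->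
  nu (-%R @^-1` A) = nu A.
Proof.
move=> mA; have mp : measurable_fun setT (fun x => (normal_pdf 0 s x)%:E).
  by apply/measurable_EFinP; exact: measurable_normal_pdf.
have mopp : measurable_fun setT (-%R : measurableTypeR R -> measurableTypeR R).
  exact: oppr_measurable.
rewrite /nu /normal_prob /=.
transitivity (\int[pushforward mu (-%R : measurableTypeR R -> measurableTypeR R)]_(x in A)
    (normal_pdf 0 s x)%:E)%E.
  rewrite ge0_integral_pushforward//.
  - apply: eq_integral => x _ /=; rewrite !normal_pdfE ?gt_eqF//.
    by rewrite /normal_fun !subr0 sqrrN.
  - exact: measurable_funTS.
  - by move=> x _; rewrite lee_fin normal_pdf_ge0.
by apply: eq_measure_integral => B mB _; exact: lebesgue_measureN.
Qed.

(** Only integrability needs a computation; that the mean is zero will come from symmetry, through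
    [integral_symmetric]. *)
Lemma normal_prob_integrable_id : nu.-integrable setT EFin.
Proof.
apply/integrableP; split; first exact: EFin_measurable.
have mu_nu := @normal_prob_dominates R 0 s.
have mp : measurable_fun setT (fun x => (normal_pdf 0 s x)%:E).
  by apply/measurable_EFinP; exact: measurable_normal_pdf.
pose nuf : {finite_measure set (measurableTypeR R) -> \bar R} := nu.
have mabs : measurable_fun setT (fun x : measurableTypeR R => `|x%:E|)%E.
  by apply: measurableT_comp => //; exact: EFin_measurable.
rewrite -(@Radon_Nikodym_SigmaFinite.change_of_variables _ _ _ nuf mu)//.
(* Both functions are densities of [nu], one by Radon-Nikodym and one by definition, hence equal
   almost everywhere. *)
have ae1 : ae_eq mu setT (Radon_Nikodym_SigmaFinite.f nuf mu) (fun x => (normal_pdf 0 s x)%:E).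
  apply: integral_ae_eq => //.
  - exact: Radon_Nikodym_SigmaFinite.f_integrable.
  - by move=> E _ mE; rewrite -Radon_Nikodym_SigmaFinite.f_integral.
pose s' := Num.sqrt 2 * s.
have s'0 : 0 < s' by rewrite mulr_gt0// sqrtr_gt0.
have ip := integrable_normal_pdf 0 s'.
(* The factor [2 s] comes from the bound on [|x|] below, the quotient from exchanging the
   normalizations of the two densities. *)
pose C : R := 2 * s * normal_peak s / normal_peak s'.
have np' := normal_peak_gt0 (lt0r_neq0 s'0).
apply: (@le_lt_trans _ _ (\int[mu]_x (C * normal_pdf 0 s' x)%:E)%E); last first.
  apply: integrable_lty => //.
  exact: (integrableZl measurableT C ip).
rewrite (@ae_eq_integral _ _ _ mu _ (fun x => `|x%:E| * (normal_pdf 0 s x)%:E)%E)//.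
- apply: ge0_le_integral => //.
  + by move=> x _; rewrite mule_ge0// lee_fin normal_pdf_ge0.
  + by apply: emeasurable_funM.
  + apply/measurable_EFinP; apply: measurable_funM => //.
    exact: measurable_normal_pdf.
  (* [|x| <= 2 s exp ((x / (2 s))^2)], so that [|x|] times the density is
     dominated by a Gaussian density of variance [2 s^2]. *)
  move=> x _; rewrite -EFinM lee_fin !normal_pdfE ?gt_eqF//.
  rewrite /C [X in _ <= X](_ : _ = normal_peak s * (2 * s * normal_fun 0 s' x)); last first.
    by field; rewrite gt_eqF.
  rewrite mulrCA ler_wpM2l ?normal_peak_ge0// /normal_fun !subr0.
  have -> : - x ^+ 2 / (s ^+ 2 *+ 2) = - (x / (2 * s)) ^+ 2 + - x ^+ 2 / (s' ^+ 2 *+ 2).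
    rewrite /s' [(Num.sqrt 2 * s) ^+ 2]exprMn sqr_sqrtr//; field; rewrite gt_eqF//.
  rewrite expRD mulrA ler_wpM2r ?expR_ge0//.
  rewrite expRN -ler_pdivlMr ?invr_gt0 ?expR_gt0// invrK.
  have := expR_ge1Dx ((x / (2 * s)) ^+ 2).
  have xE : `|x| = 2 * s * `|x / (2 * s)|.
    rewrite normrM normfV (ger0_norm (ltW (mulr_gt0 _ s0)))//.
    by rewrite mulrC mulfVK// gt_eqF// mulr_gt0.
  rewrite xE => h; rewrite ler_wpM2l ?mulr_ge0 ?(ltW s0)//; apply: le_trans h.
  by rewrite -(real_normK (num_real (x / (2 * s)))); have := sqr_ge0 (`|x / (2 * s)| - 1/2); nra.
- apply: emeasurable_funM => //.
  apply: measurable_int; exact: Radon_Nikodym_SigmaFinite.f_integrable.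
- exact: emeasurable_funM.
- exact: ae_eqe_mul2l.
Qed.

End normal_mean.

Section increments.
Context {d : measure_display} {Omega : measurableType d} {R : realType}.
Variable P : probability Omega R.

(** [X] and [- X] have the same law, so the finite mean equals its opposite. *)
Lemma integral_symmetric (X : Omega -> R) : P.-integrable setT (EFin \o X) ->
  (forall B : set R, measurable B ->
    P (X @^-1` (-%R @^-1` B)) = P (X @^-1` B)) ->
  (\int[P]_w (X w)%:E = 0)%E.
Proof.
move=> iX sX.
have mX : measurable_fun setT X by apply/measurable_EFinP; exact: measurable_int iX.
pose N w := - X w.
have mN : measurable_fun setT N by exact: measurableT_comp.
have iN : P.-integrable setT (EFin \o N).
  apply: (le_integrable measurableT _ _ iX); first exact/measurable_EFinP.
  by move=> x _ /=; rewrite normrN.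
have pX : (\int[pushforward P X]_x x%:E = \int[P]_w (X w)%:E)%E.
  by rewrite (integral_pushforward mX) ?preimage_setT//; exact: EFin_measurable.
have pN : (\int[pushforward P N]_x x%:E = \int[P]_w (N w)%:E)%E.
  by rewrite (integral_pushforward mN) ?preimage_setT//; exact: EFin_measurable.
have : (\int[P]_w (X w)%:E = - \int[P]_w (X w)%:E)%E.
  rewrite -[RHS]mulN1e -integralZl//.
  transitivity (\int[P]_w (N w)%:E)%E; last first.
    by apply: eq_integral => w _; rewrite -EFinM mulN1r.
  by rewrite -pX -pN; apply: eq_measure_integral => B mB _; exact/esym/sX.
rewrite -(fineK (integrable_fin_num measurableT iX)) => -[] h; congr EFin.
lra.
Qed.

Variables (F : R -> set (set Omega)) (n : nat) (W : R -> Omega -> 'rV[R]_n).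
Hypotheses (F_usual : usual_filtration P F) (W_brownian : brownian_motion P F W).

Lemma filtration_sub t : 0 <= t -> F t `<=` measurable.
Proof. by case: F_usual => h _ _ _ /h[]. Qed.

Lemma filtration_sa t : 0 <= t -> sigma_algebra setT (F t).
Proof. by case: F_usual => h _ _ _ /h[]. Qed.

Lemma filtration_le s t : 0 <= s -> s <= t -> F s `<=` F t.
Proof. by case: F_usual => _ h _ _ ; exact: h. Qed.

Lemma increment_law (a b : R) i A B : 0 <= a -> a < b -> F a A -> measurable B ->
  P (A `&` (fun w => W b w 0 i - W a w 0 i) @^-1` B) =
  (P A * normal_prob 0 (Num.sqrt (b - a)) B)%E.
Proof.
move=> a0 ab FA mB; have [_ _ _ law] := W_brownian.
pose Bs j := if j == i then B else setT.
rewrite [LHS](_ : _ = P (A `&` [set w | forall j, Bs j (W b w 0 j - W a w 0 j)])); last first.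
  congr (P (A `&` _)); apply/seteqP; split => w /=.
    by move=> Bw j; rewrite /Bs; case: eqP => // ->.
  by move=> /(_ i); rewrite /Bs eqxx.
rewrite law//; last by move=> j; rewrite /Bs; case: eqP.
congr (_ * _)%E; rewrite (bigD1 i)//= {1}/Bs eqxx big1 ?mule1// => j ji.
by rewrite /Bs (negbTE ji) probability_setT.
Qed.

(** For [A] in [F a], independence gives the law of [X * \1_A]: the Gaussian law weighted by [P A],
    plus an atom at [0] carrying the probability of the complement. This law is symmetric, so its
    mean is zero. *)
Lemma increment_orth (a b : R) i : 0 <= a -> a <= b ->
  orth P (F a) (fun w => W b w 0 i - W a w 0 i).
Proof.
move=> a0; rewrite le_eqVlt => /predU1P[<-|ab].
  by apply: orth_eq (orth_cst0 P (F a)) => w; rewrite subrr.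
have [_ _ mW _] := W_brownian.
set X := (X in orth _ _ X).
have mX : measurable_fun setT X.
  apply: measurable_funB; apply: measurable_wrt_measurable (mW _ _ _) => //.
  - exact/filtration_sub/(le_trans a0)/ltW.
  - exact/(le_trans a0)/ltW.
  - exact/filtration_sub.
have s0 : 0 < Num.sqrt (b - a) by rewrite sqrtr_gt0 subr_gt0.
have FT : F a setT by case: (filtration_sa a0) => F0 FD _; rewrite -(setD0 setT); exact: FD.
have iX : P.-integrable setT (EFin \o X).
  apply/integrableP; split; first exact/measurable_EFinP.
  have /integrableP[_] := normal_prob_integrable_id s0.
  rewrite [X in (X < _)%E -> _](_ : _ = (\int[P]_w `|(EFin \o X) w|)%E)//.
  transitivity (\int[pushforward P (X : Omega -> measurableTypeR R)]_x `|x%:E|)%E.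
    apply: eq_measure_integral => B mB _.
    by have := increment_law i a0 ab FT mB; rewrite probability_setT mul1e setTI => h;
      exact: (esym h).
  rewrite ge0_integral_pushforward// ?preimage_setT//.
  by apply: measurableT_comp => //; exact: EFin_measurable.
split => // A FA; have mA := filtration_sub a0 FA.
rewrite integral_indicM; apply: integral_symmetric.
  apply: (le_integrable measurableT _ _ iX).
    by apply/measurable_EFinP; apply: measurable_funM.
  move=> w _ /=; rewrite lee_fin normrM ler_piMr// indicE.
  by case: (_ \in _); rewrite ?normr1 ?normr0.
have law B : measurable B -> P ((fun w => X w * \1_A w) @^-1` B) =
    (P A * normal_prob 0 (Num.sqrt (b - a)) B + (if 0%R \in B then P (~` A) else 0))%E.
  move=> mB; rewrite -(increment_law i a0 ab FA mB) -/X.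
  rewrite [LHS](_ : _ = P (A `&` X @^-1` B `|` (if 0 \in B then ~` A else set0))).
    rewrite measureU//; first by case: ifP => // _; rewrite measure0.
    - by apply: measurableI => //; rewrite -[X in measurable X]setTI; exact: mX.
    - by case: ifP => // _; exact: measurableC.
    - apply/seteqP; split=> // w [] [Aw _]; by case: ifP.
  congr (P _); apply/seteqP; split => w /=; rewrite indicE.
    have [Aw|Aw] := boolP (w \in A).
      by rewrite mulr1 => Bw; left; split => //; exact/set_mem.
    rewrite mulr0 => B0; right; rewrite (mem_set B0) /=.
    by rewrite notin_setE in Aw.
  case=> [[Aw Bw]|]; first by rewrite mem_set// mulr1.
  case: ifPn => //; rewrite inE => B0 /= Aw.
  by rewrite memNset// mulr0.
move=> B mB; have mB' : measurable ((-%R : R -> R) @^-1` B).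
  by rewrite -[X in measurable X]setTI; exact: oppr_measurable.
rewrite (law _ mB') (law _ mB) normal_prob_opp//.
congr (_ + _)%E; congr (if _ then _ else _).
by apply/idP/idP; rewrite !inE /= oppr0.
Qed.

End increments.

(** * Multiplication by bounded variables and passage to L^2 limits *)

Section orth_more.
Context {d : measure_display} {Omega : measurableType d} {R : realType}.
Variable P : probability Omega R.
Notation mu := (@lebesgue_measure R).

Lemma orth_sub (G G' : set (set Omega)) X : G' `<=` G -> orth P G X -> orth P G' X.
Proof. by move=> GG' [iX oX]; split => // A /GG'; exact: oX. Qed.

Variable G : set (set Omega).
Hypotheses (GM : G `<=` measurable) (Gsa : sigma_algebra setT G).

Lemma orth_sum I (r : seq I) (X : I -> Omega -> R) :
  (forall i, orth P G (X i)) -> orth P G (fun w => \sum_(i <- r) X i w).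
Proof.
move=> oX; elim: r => [|i r IH].
  by apply: orth_eq (orth_cst0 P G) => w; rewrite big_nil.
by apply: orth_eq (orthD GM (oX i) IH) => w; rewrite big_cons.
Qed.

(* Layer-cake formula: [phi + C] is the integral over [-C <= u <= C] of the
   indicators of [u <= phi]. *)
Lemma orth_mul_bounded C (phi X : Omega -> R) : 0 <= C ->
  measurable_wrt G phi -> (forall w, `|phi w| <= C) ->
  orth P G X -> orth P G (fun w => X w * phi w).
Proof.
move=> C0 mphi phiC oX.
pose K (p : R * Omega) : R := if (- C <= p.1) && (p.1 <= phi p.2) then 1 else 0.
have mp2 : measurable_fun setT (fun p : R * Omega => phi p.2).
  exact: (measurableT_comp (measurable_wrt_measurable GM mphi) measurable_snd).
have mK : measurable_fun setT K.
  apply: measurable_fun_ifT => //.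
  by apply: measurable_and; apply: measurable_fun_ler.
have phib w : - C <= phi w <= C by rewrite -ler_norml.
have oK : orth P G (fun w => X w * \int[mu]_u K (u, w)).
  apply: (@orth_mulint _ _ _ P G GM Gsa (- C) C 1 K) => //.
  - by move=> u w; rewrite /K; case: ifP => _; [right|left].
  - move=> u w; rewrite /K /=; case: ifP => // /andP[-> up] /=.
    by rewrite (le_trans up)//; case/andP: (phib w).
  - move=> u; have [Cu|uC] := leP (- C) u.
      have := mphi `[u, +oo[%classic (measurable_itv _).
      congr (G _); apply/seteqP; split => w /=; rewrite in_itv/= andbT /K /= Cu /=.
        by move=> ->.
      by case: ifP => // _ /eqP; rewrite eq_sym oner_eq0.
    rewrite (_ : [set _ | _] = set0); first by case: Gsa.
    rewrite -subset0 => w /=; rewrite /K /= leNgt uC /= => /eqP.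
    by rewrite eq_sym oner_eq0.
have EK w : \int[mu]_u K (u, w) = phi w + C.
  transitivity (\int[mu]_(u in `[- C, phi w]) 1 : R).
    rewrite [RHS]Rintegral_mkcond; apply: eq_Rintegral => u _.
    by rewrite /K patchE mem_setE in_itv.
  rewrite Rintegral_cst//= mul1r lebesgue_measure_itv/= lte_fin.
  have /andP[h1 _] := phib w.
  case: ltP => h /=; first by rewrite opprK.
  by rewrite (@le_anti _ _ (phi w) (- C)) ?h1 ?h// addNr.
have := orthD GM oK (orthZ GM (- C) oX).
by apply: orth_eq => w; rewrite EK; ring.
Qed.

(** L^2 convergence is turned into L^1 closeness, which passes to the integrals over each event of
    [G]. The integrability of [X] itself comes from one [J m] at finite L^1 distance. *)
Lemma orth_cvg_L2 (J : nat -> Omega -> R) (X : Omega -> R) :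
  (forall m, orth P G (J m)) -> measurable_fun setT X ->
  (fun m => \int[P]_w (((J m w - X w) ^+ 2)%:E))%E @ \oo --> 0%E ->
  orth P G X.
Proof.
move=> oJ mX JX.
have mJ m : measurable_fun setT (J m).
  by apply/measurable_EFinP; exact: (measurable_int _ (oJ m).1).
have mD m : measurable_fun setT (fun w => J m w - X w) by exact: measurable_funB.
have mD2 m : measurable_fun setT (fun w => ((J m w - X w) ^+ 2)%:E).
  by apply/measurable_EFinP; exact: measurable_funX.
(* By [|x| <= e + x^2 / e], the first moment is at most [2 e] as soon as the second is below
   [e^2]. *)
have key e : 0 < e -> exists m, P.-integrable setT (EFin \o (fun w => J m w - X w)) /\
    (\int[P]_w `|(J m w - X w)%:E| <= (2 * e)%:E)%E.
  move=> e0.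
  have e20 : 0 < e ^+ 2 by rewrite exprn_gt0.
  have : \forall m \near \oo, (\int[P]_w (((J m w - X w) ^+ 2)%:E) < (e ^+ 2)%:E)%E.
    have /fine_cvgP[fin cv] := JX.
    near=> m.
    have fm : (\int[P]_w (((J m w - X w) ^+ 2)%:E))%E \is a fin_num by near: m.
    rewrite -(fineK fm) lte_fin; near: m.
    move/cvgrPdist_lt: cv => /(_ _ e20); apply: filterS => m /=.
    by rewrite sub0r normrN => /ltr_normlW.
  move=> [m _ /(_ m (leqnn m)) hm]; exists m.
  have iD2 : P.-integrable setT (fun w => ((J m w - X w) ^+ 2)%:E).
    apply/integrableP; split => //.
    apply: le_lt_trans (lt_trans hm (ltry _)).
    by rewrite le_eqVlt; apply/orP; left; apply/eqP; apply: eq_integral => w _ /=;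
      rewrite ger0_norm ?sqr_ge0.
  have ib : P.-integrable setT (fun w => (e + e^-1 * (J m w - X w) ^+ 2)%:E).
    apply: integrable_addr => //; first exact: finite_measure_integrable_cst.
    exact: (@integrable_scaler _ _ _ _ _ measurableT).
  have bnd w : `|J m w - X w| <= e + e^-1 * (J m w - X w) ^+ 2.
    rewrite -(ler_pM2l e0) mulrDr mulrA divff ?gt_eqF// mul1r.
    rewrite -[X in _ <= _ + X](real_normK (num_real _)).
    by have := sqr_ge0 (e - `|J m w - X w|); nra.
  split.
    exact: (integrable_ler measurableT _ _ ib).
  apply: (@le_trans _ _ (\int[P]_w (e + e^-1 * (J m w - X w) ^+ 2)%:E)%E).
    apply: ge0_le_integral => //.
    - by apply/measurable_EFinP; apply: measurableT_comp.
    - exact: measurable_int ib.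
    - by move=> w _; rewrite lee_fin.
  under eq_integral do rewrite EFinD.
  rewrite integralD//; last 2 first.
    exact: finite_measure_integrable_cst.
    exact: (@integrable_scaler _ _ _ _ _ measurableT).
  have -> : (\int[P]__ e%:E = e%:E)%E.
    by rewrite -[RHS]mule1 -(probability_setT P); exact: (integral_cst P measurableT e%:E).
  under eq_integral do rewrite EFinM.
  rewrite integralZl//.
  apply: (@le_trans _ _ (e%:E + e^-1%:E * (e ^+ 2)%:E)%E).
    by rewrite leeD2l// lee_wpmul2l ?lee_fin ?invr_ge0 ?(ltW e0)// ltW.
  by rewrite -EFinM -EFinD lee_fin expr2 mulKf ?gt_eqF// mulrDl mul1r.
have iX : P.-integrable setT (EFin \o X).
  have [m [iD _]] := key 1 ltr01.
  have := integrable_subr measurableT (oJ m).1 iD.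
  apply: eq_integrable => // w _ /=; congr EFin; ring.
split=> // A GA; have mA := GM GA.
have iXA := integrableS measurableT mA (@subsetT _ _) iX.
have fA := integrable_fin_num mA iXA.
rewrite -(fineK fA); congr EFin; apply/eqP; rewrite -normr_eq0; apply/eqP/le_anti.
rewrite normr_ge0 andbT; apply/ler_addgt0Pl => e e0; rewrite addr0.
have e20 : 0 < e / 2 by rewrite divr_gt0.
have [m [iD De]] := key _ e20.
rewrite -lee_fin -[X in (X <= _)%E]abse_EFin fineK//.
have iDA := integrableS measurableT mA (@subsetT _ _) iD.
have -> : (\int[P]_(x in A) (EFin \o X) x = - \int[P]_(w in A) (J m w - X w)%:E)%E.
  under [X in (- X)%E]eq_integral do rewrite EFinB.
  rewrite integralB_EFin//; last exact: (integrableS measurableT mA (@subsetT _ _) (oJ m).1).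
  by rewrite (oJ m).2// sub0e oppeK.
rewrite abseN (le_trans (le_abse_integral _ _ _))//.
  exact: measurable_int iDA.
apply: (@le_trans _ _ (\int[P]_w `|(J m w - X w)%:E|)%E).
  apply: ge0_subset_integral => //.
  by apply: measurableT_comp => //; exact/measurable_EFinP.
by rewrite (le_trans De)// lee_fin mulrC divfK.
Unshelve. all: by end_near. Qed.

End orth_more.

(** * Increments of the Ito integral have zero conditional expectation *)

Section ito_martingale.
Context {d : measure_display} {Omega : measurableType d} {R : realType}.
Variable P : probability Omega R.
Variables (F : R -> set (set Omega)) (n : nat) (W : R -> Omega -> 'rV[R]_n).
Hypotheses (F_usual : usual_filtration P F) (W_brownian : brownian_motion P F W).
Variable T : R.
Hypothesis T0 : 0 <= T.

(* The increment over [s, T] is again a sum over the partition truncated below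
   at [s]. *)
Lemma simple_integral_increment h s w : is_simple F T h -> 0 <= s <= T ->
  simple_integral W h T w - simple_integral W h s w =
  \sum_(k < sp_size h) \sum_(i < n)
    (W (Num.max (sp_time h k.+1) s) w 0 i - W (Num.max (sp_time h k) s) w 0 i) *
     sp_val h k w 0 i.
Proof.
move=> [h1 h2 _ _] /andP[s0 sT]; rewrite /simple_integral -sumrB.
apply: eq_bigr => k _; rewrite -sumrB; apply: eq_bigr => i _.
have /andP[k0 kT] := h1 k (ltnW (ltn_ord k)).
have /andP[k10 k1T] := h1 k.+1 (ltn_ord k).
rewrite (min_l k1T) (min_l kT) -mulrBr mulrC; congr (_ * _).
have kk := h2 _ (ltn_ord k).
have [a1|a1] := leP (sp_time h k.+1) s; have [a2|a2] := leP (sp_time h k) s.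
- ring.
- by have := le_lt_trans (le_trans kk a1) a2; rewrite ltxx.
- ring.
- ring.
Qed.

(** In each summand the Brownian increment starts at [a], the maximum of [sp_time h k] and [s]. It
    is centred given [F a], and the bounded coefficient is [F a]-measurable because
    [sp_time h k <= a]; since [s <= a], the result descends to [F s]. *)
Lemma simple_integral_orth h s : is_simple F T h -> 0 <= s <= T ->
  orth P (F s) (fun w => simple_integral W h T w - simple_integral W h s w).
Proof.
move=> hh /[dup] s0T /andP[s0 sT].
apply: (@orth_eq _ _ _ _ _ _ _ (fun w => esym (simple_integral_increment w hh s0T))).
have sM := filtration_sub F_usual s0.
apply: (orth_sum sM) => k; apply: (orth_sum sM) => i.
have [h1 h2 h3 [C hC]] := hh.
have /andP[k0 kT] := h1 k (ltnW (ltn_ord k)).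
set a := Num.max (sp_time h k) s.
have sa : s <= a by rewrite le_max lexx orbT.
have a0 : 0 <= a by rewrite (le_trans s0).
have ka : sp_time h k <= a by rewrite le_max lexx.
apply: (orth_sub (filtration_le F_usual s0 sa)).
apply: (@orth_mul_bounded _ _ _ _ _ (filtration_sub F_usual a0)
  (filtration_sa F_usual a0) `|C|) => //.
- by move=> B mB; apply: (filtration_le F_usual k0 ka); exact: h3.
- by move=> w; rewrite (le_trans (hC k w i (ltn_ord k)))// ler_norm.
- apply: (increment_orth F_usual W_brownian) => //.
  by rewrite /a ge_max !le_max (h2 _ (ltn_ord k)) lexx orbT.
Qed.

Lemma simple_integral_measurable h t : is_simple F T h -> 0 <= t ->
  measurable_fun setT (simple_integral W h t).
Proof.
move=> [h1 h2 h3 _] t0; have [_ _ mW _] := W_brownian.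
have mW' u i : 0 <= u -> measurable_fun setT (fun w => W u w 0 i).
  by move=> u0; apply: (measurable_wrt_measurable (filtration_sub F_usual u0)); exact: mW.
rewrite /simple_integral.
apply: measurable_sum => k; apply: measurable_sum => i.
have /andP[k0 kT] := h1 k (ltnW (ltn_ord k)).
have /andP[k10 k1T] := h1 k.+1 (ltn_ord k).
apply: measurable_funM.
  by apply: (measurable_wrt_measurable (filtration_sub F_usual k0)); exact: h3.
by apply: measurable_funB; apply: mW'; rewrite le_min t0 ?k0 ?k10.
Qed.

(** The increments over [[s, T]] of the approximating integrals converge in L^2, by
    [(x - y)^2 <= 2 x^2 + 2 y^2] applied to the errors at [T] and at [s]. *)
Lemma ito_increment_orth Z M s : is_ito_integral P F W T Z M -> 0 <= s <= T ->
  orth P (F s) (fun w => M T w - M s w).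
Proof.
move=> [mM _ [h [hs _ hM]]] /[dup] s0T /andP[s0 sT].
have sM := filtration_sub F_usual s0.
have T0T : 0 <= T <= T by rewrite T0 lexx.
have mMt t : 0 <= t <= T -> measurable_fun setT (M t).
  move=> /[dup] /andP[t0 _] tT.
  by apply: (measurable_wrt_measurable (filtration_sub F_usual t0)); exact: mM.
have mI m t : 0 <= t <= T -> measurable_fun setT (fun w => simple_integral W (h m) t w - M t w).
  move=> /[dup] /andP[t0 _] tT.
  by apply: measurable_funB (mMt _ tT); exact: simple_integral_measurable (hs m) t0.
pose J m w := simple_integral W (h m) T w - simple_integral W (h m) s w.
apply: (@orth_cvg_L2 _ _ _ _ _ sM J).
- by move=> m; exact: simple_integral_orth.
- by apply: measurable_funB; exact: mMt.
have cv : (fun m => 2%:E * \int[P]_w (((simple_integral W (h m) T w - M T w) ^+ 2)%:E) +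
    2%:E * \int[P]_w (((simple_integral W (h m) s w - M s w) ^+ 2)%:E))%E @ \oo --> 0%E.
  rewrite -[0%E](adde0 0%E); apply: cvgeD => //.
  - by rewrite -[0%E](mule0 2%:E); apply: cvgeZl => //; exact: hM.
  - by rewrite -[0%E](mule0 2%:E); apply: cvgeZl => //; exact: hM.
apply: squeeze_cvge (cvg_cst 0%E) cv.
apply: nearW => m; rewrite integral_ge0/=; last by move=> w _; rewrite lee_fin sqr_ge0.
have mI2 t : 0 <= t <= T -> measurable_fun setT
    (fun w => ((simple_integral W (h m) t w - M t w) ^+ 2)%:E).
  by move=> tT; apply/measurable_EFinP; apply: measurable_funX; exact: mI.
rewrite -!ge0_integralZl//; try exact: mI2; try by move=> w _; rewrite lee_fin sqr_ge0.
rewrite -ge0_integralD//.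
- apply: ge0_le_integral => //.
  + by move=> w _; rewrite lee_fin sqr_ge0.
  + apply/measurable_EFinP; apply: measurable_funX; apply: measurable_funB.
      by apply: measurable_funB; apply: simple_integral_measurable.
    by apply: measurable_funB; exact: mMt.
  + by apply: emeasurable_funD; apply: measurable_funeM; exact: mI2.
  + move=> w _; rewrite -!EFinM -EFinD lee_fin /J.
    set a := simple_integral _ _ T w; set b := simple_integral _ _ s w.
    by have := sqr_ge0 ((a - M T w) + (b - M s w)); nra.
- by move=> w _; rewrite -EFinM lee_fin mulr_ge0// sqr_ge0.
- by apply: measurable_funeM; exact: mI2.
- by move=> w _; rewrite -EFinM lee_fin mulr_ge0// sqr_ge0.
- by apply: measurable_funeM; exact: mI2.
Qed.

End ito_martingale.

(** * Joint measurability *)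

Section measurability.
Context {R : realType}.
Notation mu := (@lebesgue_measure R).

(* No measurability is required, since the integral of a nonnegative function
   is a supremum over simple functions; the running suprema [sup_t |Y_t|^2] are
   not known to be measurable. *)
Lemma le_integral_lower d' (T : measurableType d') (m : {measure set T -> \bar R})
    (f g : T -> \bar R) : (forall x, 0 <= f x)%E -> (forall x, f x <= g x)%E ->
  (\int[m]_x f x <= \int[m]_x g x)%E.
Proof.
move=> f0 fg; rewrite !ge0_integralTE//; last by move=> x; exact: le_trans (fg x).
apply: ub_ereal_sup => _ [h /= hf <-]; apply: ereal_sup_ubound => /=.
by exists h => //= x; exact: le_trans (fg x).
Qed.

(** The real integral is [fine] of the difference of two Tonelli integrals, those of the positive
    and the negative part. *)
Lemma measurable_Rintegral_snd d1 d2 (T1 : measurableType d1) (T2 : measurableType d2)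
    (m2 : {sigma_finite_measure set T2 -> \bar R}) (k : T1 * T2 -> R) :
  measurable_fun setT k -> measurable_fun setT (fun x => \int[m2]_y k (x, y)).
Proof.
move=> mk; have mEk : measurable_fun setT (EFin \o k) by exact/measurable_EFinP.
have m1 := measurable_fun_fubini_tonelli_F (m2 := m2) (EFin \o k)^\+%E.
have m2' := measurable_fun_fubini_tonelli_F (m2 := m2) (EFin \o k)^\-%E.
rewrite (_ : (fun x => _) = fine \o
    ((fun x => \int[m2]_y (EFin \o k)^\+%E (x, y)) \- (fun x => \int[m2]_y (EFin \o k)^\-%E (x, y)))%E).
  apply: (measurableT_comp (fine_measurable measurableT)).
  apply: emeasurable_funB; [apply: m1 => //|apply: m2' => //].
    exact: measurable_funepos.
  exact: measurable_funeneg.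
apply/funext => x; rewrite /Rintegral /= integralE; congr fine.
congr (_ - _)%E; apply: eq_integral => y _.
  by rewrite !funeposE.
by rewrite !funenegE.
Qed.

(** A preimage splits along the countably many fibres of [q], and on each fibre a single [G i] is in
    force. *)
Lemma measurable_fun_countable_cases d' (T : measurableType d') (I : countType)
    (D : set T) (q : T -> I) (G : I -> T -> R) : measurable D ->
  (forall i, measurable (D `&` [set p | q p = i])) ->
  (forall i, measurable_fun D (G i)) ->
  measurable_fun D (fun p => G (q p) p).
Proof.
move=> mD mq mG _ B mB.
rewrite (_ : _ `&` _ = \bigcup_i ((D `&` [set p | q p = i]) `&` (D `&` G i @^-1` B))).
  apply: countable_bigcupT_measurable => [|i]; first exact: countableP.
  by apply: measurableI => //; exact: mG.
apply/seteqP; split => [p [Dp Bp]|p [i _ [[Dp /= qi] [_ Bp]]]].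
  by exists (q p).
by split => //=; rewrite qi.
Qed.

Lemma eucl_ge0 n (z : 'rV[R]_n) : 0 <= eucl z.
Proof. exact: sqrtr_ge0. Qed.

(** A crude form of the bound by [sqrt n * e], resting on [n <= n^2]. *)
Lemma eucl_sup_le n (z : 'rV[R]_n) e : 0 <= e ->
  (forall i, `|z 0 i| <= e) -> eucl z <= n%:R * e.
Proof.
move=> e0 ze.
rewrite -[leRHS](@ger0_norm _ (n%:R * e)) ?mulr_ge0// -sqrtr_sqr.
rewrite ler_wsqrtr//; apply: (@le_trans _ _ (\sum_(i < n) e ^+ 2)).
  by apply: ler_sum => i _; rewrite -[z 0 i ^+ 2](real_normK (num_real _)) lerXn2r ?nnegrE.
rewrite sumr_const card_ord -[e ^+ 2 *+ n]mulr_natl exprMn ler_wpM2r ?sqr_ge0//.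
by rewrite -natrX ler_nat; case: n {z ze} => // n; rewrite -mulnn leq_pmulr.
Qed.

Lemma measurable_eucl d' (T : measurableType d') n (D : set T) (z : T -> 'rV[R]_n) :
  (forall i, measurable_fun D (fun p => z p 0 i)) ->
  measurable_fun D (fun p => eucl (z p)).
Proof.
move=> mz; apply: (measurableT_comp (continuous_measurable_fun (@sqrt_continuous R))).
by apply: measurable_sum => i; apply: measurable_funX.
Qed.

Let grid (k : nat) (x : R) : int := Num.floor (x * k.+1%:R).
Let ungrid (k : nat) (j : int) : R := j%:~R / k.+1%:R.

Let gridP k x : `|ungrid k (grid k x) - x| <= k.+1%:R^-1.
Proof.
have k0 : 0 < k.+1%:R :> R by rewrite ltr0n.
rewrite -(ler_pM2r k0) mulVf ?gt_eqF// -[X in _ * X](ger0_norm (ltW k0)) -normrM.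
rewrite mulrBl /ungrid divfK ?gt_eqF// distrC.
have /andP[h1 h2] := floor_itv (x * k.+1%:R).
rewrite ger0_norm ?subr_ge0// lerBlDr addrC; apply: ltW.
by rewrite /grid -[1]/(1%:~R) -intrD.
Qed.

(* The Caratheodory function [f] is approximated by rounding its last two
   arguments to a countable grid. *)
Lemma measurable_fun_lipschitz_comp d' (T : measurableType d') n (D : set T)
    (f : T -> R -> 'rV[R]_n -> R) (y : T -> R) (z : T -> 'rV[R]_n) (C : R) :
  measurable D -> 0 <= C ->
  (forall a b, measurable_fun D (fun p => f p a b)) ->
  (forall p, D p -> forall a a' b b',
    `|f p a b - f p a' b'| <= C * (`|a - a'| + eucl (b - b'))) ->
  measurable_fun D y -> (forall i, measurable_fun D (fun p => z p 0 i)) ->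
  measurable_fun D (fun p => f p (y p) (z p)).
Proof.
move=> mD C0 mf fC my mz.
pose h k p := f p (ungrid k (grid k (y p))) (\row_i ungrid k (grid k (z p 0 i))).
have mgrid k (u : T -> R) j : measurable_fun D u -> measurable (D `&` [set p | grid k (u p) = j]).
  move=> mu_.
  have := mu_ mD `[ungrid k j, ungrid k (j + 1)[%classic (measurable_itv _).
  congr (measurable (_ `&` _)); apply/seteqP; split => p /=; rewrite in_itv/= /ungrid.
    rewrite ler_pdivrMr ?ltr0n// ltr_pdivlMr ?ltr0n// => h1.
    by apply/eqP; rewrite floor_eq.
  by move/eqP; rewrite floor_eq ler_pdivrMr ?ltr0n// ltr_pdivlMr ?ltr0n.
apply: (@measurable_fun_cvg _ _ _ _ h) => [k|p Dp].
- pose q p : int * 'rV[int]_n := (grid k (y p), \row_i grid k (z p 0 i)).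
  pose G (i : int * 'rV[int]_n) p := f p (ungrid k i.1) (\row_l ungrid k (i.2 0 l)).
  have := @measurable_fun_countable_cases _ _ _ D q G mD _ (fun i => mf _ _).
  rewrite (_ : (fun p => G (q p) p) = h k); last first.
    apply/funext => p; rewrite /G /h/=; congr f.
    by apply/rowP => l; rewrite !mxE.
  apply; move=> [j v].
  rewrite (_ : _ `&` _ = (D `&` [set p | grid k (y p) = j]) `&`
     (D `&` \bigcap_(i in [set: 'I_n]) (D `&` [set p | grid k (z p 0 i) = v 0 i]))).
    apply: measurableI; first exact: mgrid.
    apply: measurableI => //.
    by apply: fin_bigcap_measurable => // i _; exact: mgrid.
  apply/seteqP; split => p /=.
    move=> [Dp [<- <-]]; split => //; split => // i _; split => //=.
    by rewrite mxE.
  move=> [[Dp yj] [_ zv]]; split => //; rewrite /q yj; congr pair.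
  by apply/rowP => i; rewrite mxE; have [] := zv i I.
- apply/cvgrPdist_le => /= e e0.
  (* Rounding moves [y] by at most [1 / (k + 1)] and [z] by at most [n / (k + 1)] in Euclidean
     norm. *)
  pose K := C * (1 + n%:R).
  have K0 : 0 <= K by rewrite mulr_ge0// addr_ge0.
  have cv : (fun k => K * k.+1%:R^-1) @ \oo --> 0.
    by rewrite -(mulr0 K); apply: cvgMr; exact: cvg_harmonic.
  move/cvgrPdist_le : cv => /(_ _ e0); apply: filterS => k /=.
  rewrite sub0r normrN ger0_norm ?mulr_ge0 ?invr_ge0// => Ke.
  rewrite distrC (le_trans (fC _ Dp _ _ _ _))//; apply: le_trans Ke.
  rewrite /K -mulrA ler_wpM2l// mulrDl mul1r lerD//.
  apply: eucl_sup_le; first by rewrite invr_ge0.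
  by move=> i; rewrite !mxE; exact: gridP.
Qed.

End measurability.

(** * The payoff along a single path *)

Section pathwise.
Context {R : realType}.
Notation mu := (@lebesgue_measure R).

(** Cutting [[a, b]] into [N + 1] equal pieces bounds the increment by [K (b - a)^2 / (N + 1)],
    which is arbitrarily small. *)
Lemma quadratic_increments_cst (Phi : R -> R) (K : R) :
  (forall a b, a <= b -> `|Phi b - Phi a| <= K * (b - a) ^+ 2) ->
  forall a b, a <= b -> Phi a = Phi b.
Proof.
move=> PhiK a b ab; apply/eqP; rewrite eq_sym -subr_eq0 -normr_eq0; apply/eqP.
have main N : `|Phi b - Phi a| * N.+1%:R <= K * (b - a) ^+ 2.
  have N0 : 0 < N.+1%:R :> R by rewrite ltr0n.
  pose e := (b - a) / N.+1%:R.
  have e0 : 0 <= e by rewrite divr_ge0// subr_ge0.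
  have step k : `|Phi (a + k%:R * e) - Phi a| <= k%:R * (K * e ^+ 2).
    elim: k => [|k IH]; first by rewrite !mul0r addr0 subrr normr0.
    rewrite -!natr1 !mulrDl !mul1r.
    have := PhiK (a + k%:R * e) (a + (k%:R * e + e)) _.
    have -> : a + (k%:R * e + e) - (a + k%:R * e) = e by ring.
    rewrite lerD2l lerDl => /(_ e0) h.
    by rewrite (le_trans (ler_distD (Phi (a + k%:R * e)) _ _))// addrC lerD.
  have Ne : N.+1%:R * e = b - a by rewrite /e mulrC divfK// gt_eqF.
  have := step N.+1; rewrite Ne [a + _]addrC subrK => h.
  apply: le_trans (ler_wpM2r (ltW N0) h) _.
  rewrite le_eqVlt; apply/orP; left; apply/eqP; rewrite -Ne; ring.
have [//|c0] := eqVneq `|Phi b - Phi a| 0.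
have {}c0 : 0 < `|Phi b - Phi a| by rewrite lt0r c0 normr_ge0.
(* This [N] exceeds the quotient by which [main N] bounds [N + 1], a contradiction. *)
pose N := Num.bound (K * (b - a) ^+ 2 / `|Phi b - Phi a|).
have := main N; rewrite -ler_pdivlMl// mulrC => h.
have hN := archi_boundP (le_trans (ler0n _ _) h).
by have := lt_le_trans hN (le_trans (_ : N%:R <= N.+1%:R) h); rewrite ltxx ler_nat leqnSn => /(_ isT).
Qed.

Lemma integrable_bndM d' (T : measurableType d') (m : {measure set T -> \bar R})
    (c : R) (h g : T -> R) : measurable_fun setT h -> (forall x, `|h x| <= c) ->
  m.-integrable setT (EFin \o g) -> m.-integrable setT (EFin \o (fun x => h x * g x)).
Proof.
move=> mh hc ig.
apply: (integrable_ler measurableT (g := fun x => c * `|g x|)).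
- by apply: measurable_funM => //; exact: integrable_measr ig.
- by move=> x _; rewrite normrM ler_wpM2r.
- exact: (integrable_scaler measurableT c (integrable_normr ig)).
Qed.

(** Integrability of every section makes the real inner integrals agree with the extended ones at
    each point. *)
Lemma Rintegral_Fubini d1 d2 (T1 : measurableType d1) (T2 : measurableType d2)
    (m1 : {sigma_finite_measure set T1 -> \bar R})
    (m2 : {sigma_finite_measure set T2 -> \bar R}) (f : T1 * T2 -> R) :
  (m1 \x m2)%E.-integrable setT (EFin \o f) ->
  (forall x, m2.-integrable setT (fun y => (f (x, y))%:E)) ->
  (forall y, m1.-integrable setT (fun x => (f (x, y))%:E)) ->
  \int[m1]_x (\int[m2]_y f (x, y)) = \int[m2]_y (\int[m1]_x f (x, y)).
Proof.
move=> fi i1 i2; rewrite {1 3}/Rintegral; congr fine.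
transitivity (\int[m1]_x \int[m2]_y (f (x, y))%:E)%E.
  by apply: eq_integral => x _; rewrite /Rintegral fineK// integrable_fin_num.
rewrite (Fubini fi).
by apply: eq_integral => y _; rewrite /Rintegral fineK// integrable_fin_num.
Qed.

Lemma lebesgue_integrable_ler (f g : R -> R) : measurable_fun setT f ->
  (forall u, `|f u| <= g u) -> mu.-integrable setT (EFin \o g) ->
  mu.-integrable setT (EFin \o f).
Proof.
move=> mf fg; apply: (@integrable_ler _ _ (measurableTypeR R) mu setT measurableT f g) => //.
Qed.

Lemma lebesgue_integrable_bndM (c : R) (h g : R -> R) : measurable_fun setT h ->
  (forall x, `|h x| <= c) ->
  mu.-integrable setT (EFin \o g) -> mu.-integrable setT (EFin \o (fun x => h x * g x)).
Proof.
by move=> mh hc; apply: (@integrable_bndM _ (measurableTypeR R) mu c h g).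
Qed.

Variables (t T lambda : R).
Hypothesis lambda0 : 0 <= lambda.
Variable r : R -> R.
Hypothesis mr : measurable_fun setT r.
Hypothesis rb : forall u, 0 <= r u <= lambda.
Hypothesis rout : forall u, ~~ (t <= u <= T) -> r u = 0.

(** This is [int_t^s r], since [r] vanishes before [t]; cutting the integrand rather than the domain
    gives an integral over the whole line with parameter [s], suited to Fubini. *)
Definition cumulated (s : R) : R := \int[mu]_u (if u <= s then r u else 0).
Notation I := cumulated.
(** Density of the first ring of a clock with intensity [r]; [integral_killing] gives its mass up to
    time [u]. *)
Definition killing (s : R) : R := r s * expR (- I s).
Notation rho := killing.

Let iab a b : mu.-integrable setT (EFin \o (\1_(`[a, b]%classic) : R -> R)).
Proof. exact: (integrable_indic_itv a b true false). Qed.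

Let ir : mu.-integrable setT (EFin \o r).
Proof.
apply: (lebesgue_integrable_ler (g := fun u => lambda * \1_(`[t, T]%classic) u)) => //.
  move=> u; rewrite indicE mem_setE in_itv/=; have /andP[r0 r1] := rb u.
  have [h|h] := boolP (t <= u <= T); first by rewrite mulr1 ger0_norm.
  by rewrite rout// normr0 mulr0.
exact: (integrable_scaler measurableT).
Qed.

Let mcut (g : R -> R) s : measurable_fun setT g ->
  measurable_fun setT (fun u : R => if u <= s then g u else 0).
Proof.
move=> mg; apply: measurable_fun_ifT => //.
by apply: measurable_fun_ler.
Qed.

Let icut (g : R -> R) s : mu.-integrable setT (EFin \o g) ->
  mu.-integrable setT (EFin \o (fun u : R => if u <= s then g u else 0)).
Proof.
move=> ig; apply: (lebesgue_integrable_ler (g := fun u => `|g u|)).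
- by apply: mcut; exact: integrable_measr ig.
- by move=> u; case: ifP => // _; rewrite normr0.
- exact: integrable_normr ig.
Qed.

Let cutB (g : R -> R) a b : a <= b -> mu.-integrable setT (EFin \o g) ->
  \int[mu]_u (if u <= b then g u else 0) - \int[mu]_u (if u <= a then g u else 0) =
  \int[mu]_u (if a < u <= b then g u else 0).
Proof.
move=> ab ig; rewrite -RintegralB//; [|exact: icut|exact: icut].
apply: eq_Rintegral => u _; have [ua|ua] := leP u a; last by rewrite subr0.
by rewrite (le_trans ua ab) subrr.
Qed.

Let icut2 (g : R -> R) a b : mu.-integrable setT (EFin \o g) ->
  mu.-integrable setT (EFin \o (fun u : R => if a < u <= b then g u else 0)).
Proof.
move=> ig; apply: (lebesgue_integrable_ler (g := fun u => `|g u|)).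
- apply: measurable_fun_ifT => //; last exact: integrable_measr ig.
  by apply: measurable_and; [exact: measurable_fun_ltr|exact: measurable_fun_ler].
- by move=> u; case: ifP => // _; rewrite normr0.
- exact: integrable_normr ig.
Qed.

(** Monotonicity and the Lipschitz bound stand in for the derivative of [I]. *)
Lemma cumulated_incr a b : a <= b -> 0 <= I b - I a <= lambda * (b - a).
Proof.
move=> ab; rewrite /I cutB//; apply/andP; split.
  by apply: Rintegral_ge0 => u _; case: ifP => // _; case/andP: (rb u).
apply: (@le_trans _ _ (\int[mu]_u (lambda * \1_(`[a, b]%classic) u))).
  apply: le_Rintegral => //; [exact: icut2|exact: (integrable_scaler measurableT)|].
  move=> u _; rewrite indicE mem_setE in_itv/=.
  have /andP[r0 r1] := rb u.
  case: ifPn => [/andP[au ->]|]; first by rewrite (ltW au) mulr1.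
  by rewrite mulr_ge0.
rewrite RintegralZl// /Rintegral integral_indic//= setIT lebesgue_measure_itv/= lte_fin.
by case: ltP => h //=; rewrite (@le_anti _ _ a b) ?ab ?h// subrr.
Qed.

Lemma cumulated_ge0 s : 0 <= I s.
Proof. by apply: Rintegral_ge0 => u _; case: ifP => // _; case/andP: (rb u). Qed.

Lemma measurable_cumulated : measurable_fun setT I.
Proof.
apply: (@measurable_Rintegral_snd _ _ _ _ _ mu (fun p : R * R => if p.2 <= p.1 then r p.2 else 0)).
apply: measurable_fun_ifT => //; first by apply: measurable_fun_ler.
exact: (measurableT_comp mr measurable_snd).
Qed.

Let E s := expR (- I s).

Let mE : measurable_fun setT E.
Proof.
apply: measurableT_comp => //; apply: measurableT_comp => //.
exact: measurable_cumulated.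
Qed.

Let Eb s : `|E s| <= 1.
Proof. by rewrite ger0_norm ?expR_ge0// expR_le1 oppr_le0 cumulated_ge0. Qed.

Lemma measurable_killing : measurable_fun setT rho.
Proof. exact: measurable_funM. Qed.

Lemma integrable_killing : mu.-integrable setT (EFin \o rho).
Proof.
apply: (lebesgue_integrable_ler measurable_killing (g := fun u => `|r u|)).
  by move=> u; rewrite normrM ler_piMr//; exact: Eb.
exact: integrable_normr ir.
Qed.

Lemma killing_bound s : 0 <= rho s <= lambda.
Proof.
have /andP[r0 r1] := rb s; rewrite /rho mulr_ge0 ?expR_ge0//=.
by rewrite (le_trans _ r1)// ler_piMr// expR_le1 oppr_le0 cumulated_ge0.
Qed.

(* [Phi] below has increments of order [(b - a)^2], because both [E a - E b] and
   [int_a^b rho] lie between [E b * dl] and [E a * dl]; hence [Phi] is constant,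
   although [I] need not be differentiable. *)
Lemma integral_killing u :
  \int[mu]_s (if s <= u then rho s else 0) = 1 - expR (- I u).
Proof.
pose Phi v := E v + \int[mu]_s (if s <= v then rho s else 0).
have PhiK a b : a <= b -> `|Phi b - Phi a| <= lambda ^+ 2 * (b - a) ^+ 2.
  move=> ab; rewrite /Phi opprD addrACA cutB//; last exact: integrable_killing.
  set J := (X in `|_ + X|).
  have /andP[d0 d1] := cumulated_incr ab.
  set dl := I b - I a in d0 d1.
  have irab := icut2 a b ir.
  have dlE : dl = \int[mu]_u (if a < u <= b then r u else 0) by rewrite /dl cutB.
  have Eab : E a = E b * expR dl by rewrite /E -expRD; congr expR; rewrite /dl; ring.
  have Eba : E b = E a * expR (- dl) by rewrite /E -expRD; congr expR; rewrite /dl; ring.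
  have Ea0 : 0 <= E a by exact: expR_ge0.
  have Eb0 : 0 <= E b by exact: expR_ge0.
  have Ea1 : E a <= 1 by have := Eb a; rewrite ger0_norm.
  have l1 := expR_ge1Dx dl; have l2 := expR_ge1Dx (- dl).
  have J1 : E b * dl <= J.
    rewrite dlE -RintegralZl//; apply: le_Rintegral => //.
    - exact: (integrable_scaler measurableT).
    - exact/icut2/integrable_killing.
    - move=> s _; case: ifPn => [/andP[_ sb]|]; last by rewrite mulr0.
      rewrite /rho mulrC ler_wpM2l//; first by case/andP: (rb s).
      by rewrite ler_expR lerN2 -subr_ge0; case/andP: (cumulated_incr sb).
  have J2 : J <= E a * dl.
    rewrite dlE -RintegralZl//; apply: le_Rintegral => //.
    - exact/icut2/integrable_killing.
    - exact: (integrable_scaler measurableT).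
    - move=> s _; case: ifPn => [/andP[sa _]|]; last by rewrite mulr0.
      rewrite /rho mulrC ler_wpM2r//; first by case/andP: (rb s).
      by rewrite ler_expR lerN2 -subr_ge0; case/andP: (cumulated_incr (ltW sa)).
  (* By [1 + x <= exp x] at [dl] and at [- dl], the difference [E a - E b] lies, like [J], in the
     interval from [E b * dl] to [E a * dl], whose length is [dl * (E a - E b)]. *)
  have D1 : E b * dl <= E a - E b by rewrite Eab; nra.
  have D2 : E a - E b <= E a * dl by rewrite Eba; nra.
  have D3 : dl * (E a - E b) <= dl * dl.
    by rewrite ler_wpM2l// (le_trans D2)// ler_piMl.
  have D4 : dl * dl <= (lambda * (b - a)) * (lambda * (b - a)) by exact: ler_pM.
  rewrite -exprMn expr2; apply: le_trans D4; apply: le_trans D3.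
  by rewrite ler_norml; apply/andP; split; nra.
have cst a b : a <= b -> Phi a = Phi b by exact: quadratic_increments_cst PhiK _ _.
(* Before [t] the control vanishes, hence [I v = 0] and [Phi v = 1]; the minimum with [u] ensures
   [v <= u]. *)
pose v := Num.min u (t - 1).
have vt : v < t by rewrite gt_min ltrBlDr ltrDl ltr01 orbT.
have cut0 (g : R -> R) : (forall x, ~~ (t <= x <= T) -> g x = 0) ->
    \int[mu]_s (if s <= v then g s else 0) = 0.
  move=> gout; rewrite (@eq_Rintegral _ _ _ _ _ (fun=> 0))//.
    by rewrite Rintegral_cst// mul0r.
  move=> s _; case: ifP => // sv; apply: gout.
  by rewrite negb_and -ltNge (le_lt_trans sv vt).
have := cst v u; rewrite ge_min lexx /= => /(_ isT).
rewrite /Phi /E /I (cut0 r)// oppr0 expR0 (cut0 rho) ?addr0 => [->|x xout].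
  by rewrite addrC addKr.
by rewrite /rho rout// mul0r.
Qed.

Variables (phi y st : R -> R) (xi : R).
Hypothesis iphi : mu.-integrable setT (EFin \o phi).
Hypothesis iy : mu.-integrable setT (EFin \o y).
Hypothesis ist : mu.-integrable setT (EFin \o st).
Hypothesis phi_out : forall u, ~~ (t <= u <= T) -> phi u = 0.
Hypothesis y_out : forall u, ~~ (t <= u <= T) -> y u = 0.
Hypothesis st_out : forall u, ~~ (t <= u <= T) -> st u = 0.

Let g u := phi u + lambda * Num.max 0 (st u - y u).

(** The [D_s] of the overview; the upper limit [T] is hidden in [phi], [y] and [st], which are
    assumed to vanish outside [[t, T]]. *)
Definition remainder (s : R) : R :=
  xi - y s + \int[mu]_u (if s <= u then phi u + lambda * Num.max 0 (st u - y u) else 0).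

Let mphi : measurable_fun setT phi. Proof. exact: integrable_measr iphi. Qed.
Let my : measurable_fun setT y. Proof. exact: integrable_measr iy. Qed.
Let mst : measurable_fun setT st. Proof. exact: integrable_measr ist. Qed.

Let isy : mu.-integrable setT (EFin \o (fun u => st u - y u)).
Proof. exact: integrable_subr. Qed.

Let mmax : measurable_fun setT (fun u => Num.max 0 (st u - y u)).
Proof. by apply: measurable_maxr => //; exact: measurable_funB. Qed.

Let imax : mu.-integrable setT (EFin \o (fun u => lambda * Num.max 0 (st u - y u))).
Proof.
apply: (@integrable_scaler _ _ (measurableTypeR R) mu setT measurableT).
apply: (lebesgue_integrable_ler (g := fun u => `|st u - y u|)) => //.
  move=> u; rewrite ger0_norm ?le_max ?lexx//.
  by rewrite ge_max normr_ge0 ler_norm.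
exact: (integrable_normr isy).
Qed.

Let ig : mu.-integrable setT (EFin \o g).
Proof. exact: integrable_addr. Qed.

Let mg : measurable_fun setT g. Proof. exact: integrable_measr ig. Qed.

Let icutr s : mu.-integrable setT (EFin \o (fun u : R => if s <= u then g u else 0)).
Proof.
apply: (lebesgue_integrable_ler (g := fun u => `|g u|)).
- by apply: measurable_fun_ifT => //; apply: measurable_fun_ler.
- by move=> u; case: ifP => // _; rewrite normr0.
- exact: (integrable_normr ig).
Qed.

Let G s := \int[mu]_u (if s <= u then g u else 0).

Let mG : measurable_fun setT G.
Proof.
apply: (@measurable_Rintegral_snd _ _ _ _ _ mu (fun p : R * R => if p.1 <= p.2 then g p.2 else 0)).
apply: measurable_fun_ifT => //; first by apply: measurable_fun_ler.
exact: (measurableT_comp mg measurable_snd).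
Qed.

Let Gb s : `|G s| <= \int[mu]_u `|g u|.
Proof.
rewrite (le_trans (le_normr_Rintegral _ (icutr s)))//.
apply: le_Rintegral => //; [exact: (integrable_normr (icutr s))|exact: (integrable_normr ig)|].
by move=> u _; case: ifP => // _; rewrite normr0.
Qed.

Let irG : mu.-integrable setT (EFin \o (fun s => rho s * G s)).
Proof.
have := lebesgue_integrable_bndM mG Gb integrable_killing.
by under [X in integrable _ _ (_ \o X)]eq_fun do rewrite mulrC.
Qed.

(** Fubini on the region [s <= u]: for fixed [u], the mass of [rho] up to [u] is [1 - E u] by
    [integral_killing]. *)
Let integral_rho_G : \int[mu]_s (rho s * G s) = \int[mu]_u (g u * (1 - E u)).
Proof.
pose f (p : R * R) := rho p.1 * (if p.1 <= p.2 then g p.2 else 0).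
have rhoN s : `|rho s| <= lambda.
  by have /andP[r0 r1] := killing_bound s; rewrite ger0_norm.
transitivity (\int[mu]_s \int[mu]_u f (s, u)).
  by apply: eq_Rintegral => s _; rewrite /f /= RintegralZl.
rewrite (@Rintegral_Fubini _ _ _ _ mu mu f).
- apply: eq_Rintegral => u _; rewrite -integral_killing -RintegralZl//.
    by apply: eq_Rintegral => s _; rewrite /f/=; case: ifP => _; rewrite ?mulr0// mulrC.
  exact/icut/integrable_killing.
- apply: (@integrable_ler _ _ _ (mu \x mu)%E setT measurableT _ (fun p => `|rho p.1| * `|g p.2|)).
  + apply: measurable_funM; first exact: (measurableT_comp measurable_killing measurable_fst).
    apply: measurable_fun_ifT => //; first by apply: measurable_fun_ler.
    exact: (measurableT_comp mg measurable_snd).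
  + move=> [s u] _ /=; rewrite /f/= normrM ler_wpM2l//.
    by case: ifP => // _; rewrite normr0.
  + apply: (@integrable_prodM _ _ _ _ _ mu mu (fun s => `|rho s|) (fun u => `|g u|)).
      exact: (integrable_normr integrable_killing).
    exact: (integrable_normr ig).
- by move=> s; exact: (integrable_scaler measurableT (rho s) (icutr s)).
- move=> u; apply: (lebesgue_integrable_ler (g := fun s => `|g u| * `|rho s|)).
  + apply: measurable_funM; first exact: measurable_killing.
    rewrite /=; apply: measurable_fun_ifT => //.
    exact: (measurable_fun_ler (@measurable_id _ R setT) (measurable_cst (u : R))).
  + move=> s; rewrite /f/= normrM mulrC ler_wpM2r//.
    by case: ifP => // _; rewrite normr0.
  + exact: (integrable_scaler measurableT `|g u| (integrable_normr integrable_killing)).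
Qed.

Let iry : mu.-integrable setT (EFin \o (fun s => rho s * y s)).
Proof.
apply: (lebesgue_integrable_bndM (c := lambda)) iy; first exact: measurable_killing.
by move=> s; have /andP[r0 r1] := killing_bound s; rewrite ger0_norm.
Qed.

(** Once the integral of [rho * remainder] is reduced to single integrals, the identity is linear in
    the integrals of [g], of [rho y], of [g (1 - E)] and of the last integrand. *)
Lemma payoff_decomposition :
  \int[mu]_s ((phi s + r s * st s) * expR (- I s)) + expR (- I T) * xi =
  y t + (remainder t - \int[mu]_s (rho s * remainder s)) +
  \int[mu]_s (expR (- I s) *
     (r s * (st s - y s) - lambda * Num.max 0 (st s - y s))).
Proof.
have i1 : mu.-integrable setT (EFin \o (fun s => rho s * xi)).
  have := @integrable_scaler _ _ (measurableTypeR R) mu setT measurableT xi _ integrable_killing.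
  by under [X in integrable _ _ X -> _]eq_fun do rewrite mulrC.
have ErhoT : \int[mu]_s rho s = 1 - E T.
  rewrite -integral_killing; apply: eq_Rintegral => s _.
  case: ifPn => // sT; rewrite /rho rout ?mul0r//.
  by rewrite negb_and sT orbT.
have -> : \int[mu]_s (rho s * remainder s) =
    (1 - E T) * xi - \int[mu]_s (rho s * y s) + \int[mu]_u (g u * (1 - E u)).
  rewrite -integral_rho_G -ErhoT -RintegralZr//; last exact: integrable_killing.
  rewrite -RintegralB// -RintegralD//; last exact: integrable_subr.
  apply: eq_Rintegral => s _; have -> : remainder s = xi - y s + G s by [].
  ring.
have -> : remainder t = xi - y t + \int[mu]_u g u.
  rewrite /remainder; congr (_ + _); apply: eq_Rintegral => u _.
  case: ifPn => // tu; have out : ~~ (t <= u <= T) by rewrite negb_and tu.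
  by rewrite /g phi_out// y_out// st_out// subrr maxxx mulr0 addr0.
have ig1 : mu.-integrable setT (EFin \o (fun u => g u * (1 - E u))).
  have : mu.-integrable setT (EFin \o (fun u => (1 - E u) * g u)).
    apply: (lebesgue_integrable_bndM (c := 1)) => //; first exact: measurable_funB.
    move=> u; have := Eb u; rewrite ger0_norm ?expR_ge0// => E1.
    by rewrite ger0_norm ?subr_ge0// lerBlDr lerDl expR_ge0.
  by under [X in integrable _ _ (_ \o X) -> _]eq_fun do rewrite mulrC.
have iB : mu.-integrable setT (EFin \o (fun s => E s *
     (r s * (st s - y s) - lambda * Num.max 0 (st s - y s)))).
  apply: (lebesgue_integrable_bndM mE Eb).
  apply: integrable_subr => //; apply: (lebesgue_integrable_bndM (c := lambda)) => //.
  by move=> u; have /andP[r0 r1] := rb u; rewrite ger0_norm.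
(* Pointwise, [phi] is [g - lambda max (0, st - y)], [r st] is [r (st - y) + r y], and [g E] is
   [g - g (1 - E)]. *)
have -> : \int[mu]_s ((phi s + r s * st s) * expR (- I s)) =
    \int[mu]_u g u + \int[mu]_s (rho s * y s) - \int[mu]_u (g u * (1 - E u)) +
    \int[mu]_s (E s * (r s * (st s - y s) - lambda * Num.max 0 (st s - y s))).
  rewrite -RintegralD// -RintegralB//; last exact: integrable_addr.
  rewrite -RintegralD//; last by apply: integrable_subr => //; exact: integrable_addr.
  by apply: eq_Rintegral => s _; rewrite /g /rho /E; ring.
rewrite /E; ring.
Qed.

(** With [x = st s - y s], one has [r s * x <= r s * max (0, x) <= lambda * max (0, x)], because
    [0 <= r s <= lambda]. *)
Lemma gain_le0 : \int[mu]_s (expR (- I s) *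
     (r s * (st s - y s) - lambda * Num.max 0 (st s - y s))) <= 0.
Proof.
rewrite -oppr_ge0 -mulN1r -RintegralZl//; last first.
  apply: (lebesgue_integrable_bndM mE Eb).
  apply: integrable_subr => //; apply: (lebesgue_integrable_bndM (c := lambda)) => //.
  by move=> u; have /andP[r0 r1] := rb u; rewrite ger0_norm.
apply: Rintegral_ge0 => s _; rewrite mulN1r oppr_ge0.
rewrite mulr_ge0_le0 ?expR_ge0// subr_le0.
have /andP[r0 r1] := rb s.
apply: (@le_trans _ _ (r s * Num.max 0 (st s - y s))).
  by rewrite ler_wpM2l// le_max lexx orbT.
by rewrite ler_wpM2r// le_max lexx.
Qed.

End pathwise.

(** * Conditional expectation of the payoff *)

Section conditional.
Context {d : measure_display} {Omega : measurableType d} {R : realType}.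
Variables (P : probability Omega R) (F : R -> set (set Omega)).
Hypothesis F_usual : usual_filtration P F.
Notation mu := (@lebesgue_measure R).
Notation muP := (mu \x P)%E.

Variables (t T lambda : R).
Hypotheses (t0 : 0 <= t) (tT : t <= T) (lambda0 : 0 < lambda).

Variables (r phi y st : R * Omega -> R) (xi : Omega -> R).
Hypothesis mr : measurable_fun setT r.
Hypothesis r0l : forall u w, r (u, w) = 0 \/ r (u, w) = lambda.
Hypothesis rF : forall u, t <= u <= T -> F u [set w | r (u, w) = lambda].
Hypothesis rout : forall u w, ~~ (t <= u <= T) -> r (u, w) = 0.

Hypothesis ixi : P.-integrable setT (EFin \o xi).
Hypothesis iphi : muP.-integrable setT (EFin \o phi).
Hypothesis iy : muP.-integrable setT (EFin \o y).
Hypothesis ist : muP.-integrable setT (EFin \o st).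
Hypothesis iphi_w : forall w, mu.-integrable setT (EFin \o (fun u => phi (u, w))).
Hypothesis iy_w : forall w, mu.-integrable setT (EFin \o (fun u => y (u, w))).
Hypothesis ist_w : forall w, mu.-integrable setT (EFin \o (fun u => st (u, w))).
Hypothesis phi_out : forall u w, ~~ (t <= u <= T) -> phi (u, w) = 0.
Hypothesis y_out : forall u w, ~~ (t <= u <= T) -> y (u, w) = 0.
Hypothesis st_out : forall u w, ~~ (t <= u <= T) -> st (u, w) = 0.

Let rw w u := r (u, w).
Let D s w := remainder lambda (fun u => phi (u, w)) (fun u => y (u, w))
  (fun u => st (u, w)) (xi w) s.

Hypothesis oD : forall s, t <= s <= T -> orth P (F s) (D s).

Let rb w u : 0 <= rw w u <= lambda.
Proof. by rewrite /rw; case: (r0l u w) => ->; rewrite lexx (ltW lambda0). Qed.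

Let g (p : R * Omega) := phi p + lambda * Num.max 0 (st p - y p).

Let mphi : measurable_fun setT phi.
Proof. by apply/measurable_EFinP; exact: measurable_int iphi. Qed.
Let my : measurable_fun setT y.
Proof. by apply/measurable_EFinP; exact: measurable_int iy. Qed.
Let mst : measurable_fun setT st.
Proof. by apply/measurable_EFinP; exact: measurable_int ist. Qed.

Let mmax : measurable_fun setT (fun p => Num.max 0 (st p - y p)).
Proof. by apply: measurable_maxr => //; exact: measurable_funB. Qed.

Let mg : measurable_fun setT g.
Proof. by apply: measurable_funD => //; exact: measurable_funM. Qed.

Let max_le (x : R) : Num.max 0 x <= `|x|.
Proof. by rewrite ge_max normr_ge0 ler_norm. Qed.

Let ig : muP.-integrable setT (EFin \o g).
Proof.
apply: (@integrable_addr _ _ _ muP setT measurableT) => //.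
apply: (@integrable_scaler _ _ _ muP setT measurableT).
apply: (@integrable_ler _ _ _ muP setT measurableT _ (fun p => `|st p - y p|)) => //.
  by move=> p _; rewrite ger0_norm ?le_max ?lexx.
exact: (integrable_normr (integrable_subr measurableT ist iy)).
Qed.

Let ig_w w : mu.-integrable setT (EFin \o (fun u => g (u, w))).
Proof.
apply: integrable_addr => //.
apply: (@integrable_scaler _ _ (measurableTypeR R) mu setT measurableT).
apply: (lebesgue_integrable_ler (g := fun u => `|st (u, w) - y (u, w)|)) => //.
- exact: (measurable_fun_pair1 w mmax).
- by move=> u; rewrite ger0_norm ?le_max ?lexx.
- exact: (integrable_normr (integrable_subr measurableT (ist_w w) (iy_w w))).
Qed.

Let mC : measurable_fun setT (fun p : R * Omega => expR (- cumulated (rw p.2) p.1)).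
Proof.
apply: measurableT_comp => //; apply: measurableT_comp => //.
apply: (@measurable_Rintegral_snd _ _ _ _ _ mu
  (fun q : (R * Omega) * R => if q.2 <= q.1.1 then r (q.2, q.1.2) else 0)).
apply: measurable_fun_ifT => //.
  apply: measurable_fun_ler => //.
  exact: (measurableT_comp measurable_fst measurable_fst).
apply: (measurableT_comp mr); apply: measurable_fun_pair => //.
exact: (measurableT_comp measurable_snd measurable_fst).
Qed.

Let mD : measurable_fun setT (fun p : R * Omega => D p.1 p.2).
Proof.
apply: measurable_funD.
  apply: measurable_funB; last by under eq_fun do rewrite -surjective_pairing.
  by apply: (measurableT_comp _ measurable_snd); apply/measurable_EFinP; exact: measurable_int ixi.
apply: (@measurable_Rintegral_snd _ _ _ _ _ mu
  (fun q : (R * Omega) * R => if q.1.1 <= q.2 then g (q.2, q.1.2) else 0)).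
apply: measurable_fun_ifT => //.
  apply: measurable_fun_ler => //.
  exact: (measurableT_comp measurable_fst measurable_fst).
apply: (measurableT_comp mg); apply: measurable_fun_pair => //.
exact: (measurableT_comp measurable_snd measurable_fst).
Qed.

Let H (p : R * Omega) := killing (rw p.2) p.1 * D p.1 p.2.

Let mH : measurable_fun setT H.
Proof.
apply: measurable_funM mD; apply: measurable_funM mC.
by under eq_fun do rewrite /rw -surjective_pairing.
Qed.

Let cut_g_bound s w : `|\int[mu]_u (if s <= u then g (u, w) else 0)| <= \int[mu]_u `|g (u, w)|.
Proof.
have ic : mu.-integrable setT (EFin \o (fun u : R => if s <= u then g (u, w) else 0)).
  apply: (lebesgue_integrable_ler (g := fun u => `|g (u, w)|)).
  - apply: measurable_fun_ifT => //; first by apply: measurable_fun_ler.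
    exact: (measurable_fun_pair1 w mg).
  - by move=> u; case: ifP => // _; rewrite normr0.
  - exact: (integrable_normr (ig_w w)).
rewrite (le_trans (le_normr_Rintegral _ ic))//.
apply: le_Rintegral => //; [exact: (integrable_normr ic)|exact: (integrable_normr (ig_w w))|].
by move=> u _; case: ifP => // _; rewrite normr0.
Qed.

(** On the window the killing density is at most [lambda], and [|D s|] is at most [|xi| + |y|] plus
    the path integral of [|g|]; [X] gathers what does not depend on [s]. *)
Let iH : muP.-integrable setT (EFin \o H).
Proof.
pose ind (s : R) : R := \1_(`[t, T]%classic) s.
pose X w := `|xi w| + \int[mu]_u `|g (u, w)|.
have iX : P.-integrable setT (EFin \o X).
  apply: (integrable_addr measurableT); first exact: (integrable_normr ixi).
  exact: (integrable_Rintegral_fst (integrable_normr ig)).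
have iind : mu.-integrable setT (EFin \o ind) by exact: (integrable_indic_itv t T true false).
apply: (@integrable_ler _ _ _ muP setT measurableT _
  (fun p => lambda * (ind p.1 * X p.2 + `|y p|))) => //.
- move=> [s w] _; rewrite /H/= normrM.
  have /andP[k0 k1] := killing_bound (rb w) s.
  have [ts|ts] := boolP (t <= s <= T); last first.
    rewrite /killing /rw rout// mul0r normr0 mul0r.
    rewrite mulr_ge0 ?(ltW lambda0)// addr_ge0// mulr_ge0//.
    by rewrite addr_ge0//; apply: Rintegral_ge0.
  have -> : ind s = 1 by rewrite /ind indicE mem_setE in_itv/= ts.
  rewrite mul1r ger0_norm// ler_pM// /D /remainder /X.
  rewrite (le_trans (ler_normD _ _))// [leRHS]addrAC lerD//; last exact: cut_g_bound.
  exact: ler_normB.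
- apply: (@integrable_scaler _ _ _ muP setT measurableT).
  apply: (@integrable_addr _ _ _ muP setT measurableT).
    exact: (@integrable_prodM _ _ _ _ _ mu P ind X).
  exact: (integrable_normr iy).
Qed.

(** [H (s, _)] is [r_s] times [D s * exp (- I_s)]. The exponential is handled by [orth_mulexpN] with
    the control cut at [s], whose sections are events of [F u] with [u <= s], hence of [F s]; the
    factor [r_s] is [lambda] times the indicator of an event of [F s]. *)
Let oH s A : F t A -> (\int[P]_(w in A) (H (s, w))%:E = 0)%E.
Proof.
move=> FA; have [ts|ts] := boolP (t <= s <= T); last first.
  rewrite /H /=; under eq_integral do rewrite /killing /rw rout// mul0r mul0r.
  by rewrite integral0.
have /andP[ts1 sT] := ts; have s0 : 0 <= s := le_trans t0 ts1.
have sM := filtration_sub F_usual s0; have sS := filtration_sa F_usual s0.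
pose K (p : R * Omega) := if p.1 <= s then r p else 0.
have oE : orth P (F s) (fun w => D s w * expR (- cumulated (rw w) s)).
  apply: (@orth_mulexpN _ _ _ P _ sM sS t s lambda K) => //.
  - exact: ltW.
  - by apply: measurable_fun_ifT => //; apply: measurable_fun_ler.
  - by move=> u w; rewrite /K; case: ifP => _; [exact: r0l|left].
  - move=> u w; rewrite negb_and /K /= => us.
    case: ifP => // us'; rewrite rout//.
    by move: us; rewrite us' orbF negb_and => ->.
  - move=> u; rewrite /K /=; have [us|us] := leP u s; last first.
      rewrite (_ : [set _ | _] = set0); first by case: sS.
      by rewrite -subset0 => w /= /esym/eqP; rewrite gt_eqF.
    have [tu|tu] := boolP (t <= u <= T).
      have u0 : 0 <= u by case/andP: tu => tu _; exact: le_trans t0 tu.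
      by apply: (filtration_le F_usual u0 us); exact: rF.
    rewrite (_ : [set _ | _] = set0); first by case: sS.
    by rewrite -subset0 => w /=; rewrite rout// => /esym/eqP; rewrite gt_eqF.
  - exact: oD.
have FsA : F s A by apply: (filtration_le F_usual t0 ts1).
have [_ /(_ A FsA) <-] := orthZ sM lambda (orth_indic sM sS oE (rF ts)).
apply: eq_integral => w _; congr EFin; rewrite /H /killing /rw /= indicE.
have [e|e] := boolP (w \in [set w | r (s, w) = lambda]).
  by rewrite inE/= in e; rewrite mulr1 e; ring.
rewrite notin_setE /= in e; by have [->|//] := r0l s w; rewrite mulr0 mulr0 !mul0r.
Qed.

Lemma orth_killed_remainder : orth P (F t) (fun w => D t w - \int[mu]_s H (s, w)).
Proof.
have tM := filtration_sub F_usual t0.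
have := orthD tM (oD _) (orthZ tM (-1) (orth_int tM iH oH)).
rewrite lexx tT => /(_ isT); apply: orth_eq => w.
by rewrite mulN1r.
Qed.

Definition gain w := \int[mu]_s (expR (- cumulated (rw w) s) *
  (r (s, w) * (st (s, w) - y (s, w)) - lambda * Num.max 0 (st (s, w) - y (s, w)))).

Lemma integrable_gain : P.-integrable setT (EFin \o gain).
Proof.
apply: (@integrable_Rintegral_fst _ _ _ P (fun p : R * Omega => expR (- cumulated (rw p.2) p.1) *
  (r p * (st p - y p) - lambda * Num.max 0 (st p - y p)))).
apply: (@integrable_ler _ _ _ muP setT measurableT _
  (fun p => 2 * lambda * `|st p - y p|)) => //.
- apply: measurable_funM => //; apply: measurable_funB.
    by apply: measurable_funM => //; exact: measurable_funB.
  exact: measurable_funM.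
- move=> [s w] _; rewrite normrM -[leRHS]mul1r ler_pM//.
    by rewrite ger0_norm ?expR_ge0// expR_le1 oppr_le0; exact: cumulated_ge0 (rb w) _.
  rewrite (le_trans (ler_normB _ _))// -mulrA mulr_natl mulr2n.
  have /andP[r0 r1] := rb w s.
  rewrite lerD// normrM.
    by rewrite ler_wpM2r// ger0_norm.
  by rewrite (ger0_norm (ltW lambda0)) ler_wpM2l ?(ltW lambda0)// ger0_norm ?le_max ?lexx.
- apply: (@integrable_scaler _ _ _ muP setT measurableT).
  exact: (integrable_normr (integrable_subr measurableT ist iy)).
Qed.

Lemma gain_nonpos w : gain w <= 0.
Proof.
apply: (gain_le0 _ (rb w) (iy_w w) (ist_w w)).
exact: (measurable_fun_pair1 w mr).
Qed.

Lemma gain_optimal w : (forall s, r (s, w) * (st (s, w) - y (s, w)) =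
  lambda * Num.max 0 (st (s, w) - y (s, w))) -> gain w = 0.
Proof.
move=> h; rewrite /gain (@eq_Rintegral _ _ _ _ _ (fun=> 0)).
  by rewrite Rintegral_cst// mul0r.
by move=> s _; rewrite h subrr mulr0.
Qed.

Lemma payoff_decomposition_gain w :
  \int[mu]_s ((phi (s, w) + r (s, w) * st (s, w)) * expR (- cumulated (rw w) s)) +
  expR (- cumulated (rw w) T) * xi w =
  y (t, w) + (D t w - \int[mu]_s H (s, w)) + gain w.
Proof.
apply: (payoff_decomposition (ltW lambda0) _ (rb w)) => //.
- exact: (measurable_fun_pair1 w mr).
- by move=> u; exact: rout.
- by move=> u; exact: phi_out.
- by move=> u; exact: y_out.
- by move=> u; exact: st_out.
Qed.

End conditional.

(** * Application to the penalized BSDE *)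

Section integrability.
Context {d : measure_display} {Omega : measurableType d} {R : realType}.
Variables (P : probability Omega R).
Notation mu := (@lebesgue_measure R).
Notation muP := (mu \x P)%E.

(** Completeness supplies the measurability of [X']. In the applications [X'] is the payoff or
    [D s], identified only off a null set. *)
Lemma integrable_ae_eq (X X' : Omega -> R) : measure_is_complete P ->
  {ae P, forall w, X w = X' w} ->
  P.-integrable setT (EFin \o X) -> P.-integrable setT (EFin \o X').
Proof.
move=> cP XX' iX.
have XX'E : ae_eq P setT (EFin \o X) (EFin \o X').
  by apply: filterS XX' => w /= -> _.
have mX' := ae_measurable_fun cP XX'E (measurable_int _ iX).
apply/integrableP; split => //; have /integrableP[mX] := iX.
rewrite (@ae_eq_integral _ _ _ P _ (abse \o (EFin \o X')))//.
- exact: measurableT_comp.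
- exact: measurableT_comp.
- by apply: filterS XX' => w /= -> _.
Qed.

Lemma integral_ae_eq_sub (A : set Omega) (X X' : Omega -> R) : measurable A ->
  {ae P, forall w, X w = X' w} ->
  P.-integrable setT (EFin \o X) -> P.-integrable setT (EFin \o X') ->
  (\int[P]_(w in A) (X w)%:E = \int[P]_(w in A) (X' w)%:E)%E.
Proof.
move=> mA XX' iX iX'; apply: ae_eq_integral => //.
- by apply: measurable_funTS; exact: measurable_int iX.
- by apply: measurable_funTS; exact: measurable_int iX'.
- by apply: filterS XX' => w /= -> _.
Qed.

Lemma orth_ae (G : set (set Omega)) (X X' : Omega -> R) : measure_is_complete P ->
  G `<=` measurable ->
  {ae P, forall w, X w = X' w} -> orth P G X -> orth P G X'.
Proof.
move=> cP GM XX' [iX oX]; have iX' := integrable_ae_eq cP XX' iX.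
by split => // A GA; rewrite -(oX A GA) -(integral_ae_eq_sub (GM _ GA) XX').
Qed.

Variable T : R.
Hypothesis T0 : 0 <= T.
Let itv : set R := `[0, T]%classic.

(** [|X| <= 1 + X^2] on the window, which has finite measure. *)
Lemma integrable_of_sqr (X : R * Omega -> R) : measurable_fun setT X ->
  (forall s w, ~~ (0 <= s <= T) -> X (s, w) = 0) ->
  muP.-integrable setT (fun p => (X p ^+ 2)%:E) ->
  muP.-integrable setT (EFin \o X).
Proof.
move=> mX Xout iX2.
have i1 : muP.-integrable setT (EFin \o (fun p : R * Omega => \1_itv p.1 * 1)).
  apply: (@integrable_prodM _ _ _ _ _ mu P \1_itv (fun=> 1)).
    exact: (integrable_indic_itv 0 T true false).
  exact: finite_measure_integrable_cst.
apply: (@integrable_ler _ _ _ muP setT measurableT _ (fun p => \1_itv p.1 * 1 + X p ^+ 2)) => //.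
- move=> [s w] _; have [h|h] := boolP (0 <= s <= T); last first.
    by rewrite Xout// normr0 expr0n/= addr0 mulr1.
  rewrite indicE mem_setE in_itv/= h mulr1 -[true%:R]/(1 : R).
  rewrite -(real_normK (num_real (X (s, w)))).
  by have := sqr_ge0 (`|X (s, w)| - 1/2); nra.
- exact: (@integrable_addr _ _ _ muP setT measurableT).
Qed.

(** Meant for [Y] and [S]: the expected squared supremum bounds the second moment at each time
    uniformly, and time is integrated last. *)
Lemma integrable_of_unif_L2 (X : R * Omega -> R) (K : R) : measurable_fun setT X ->
  (forall s w, ~~ (0 <= s <= T) -> X (s, w) = 0) ->
  (forall s, 0 <= s <= T -> (\int[P]_w (X (s, w) ^+ 2)%:E <= K%:E)%E) ->
  muP.-integrable setT (EFin \o X).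
Proof.
move=> mX Xout XK; apply: integrable_of_sqr => //.
apply/integrable12ltyP.
  by apply/measurable_EFinP; exact: measurable_funX.
apply: (@le_lt_trans _ _ (\int[mu]_s (K * \1_itv s)%:E)%E); last first.
  apply: integrable_lty => //.
  exact: (integrable_scaler measurableT K (integrable_indic_itv 0 T true false)).
apply: le_integral_lower => s; first exact: integral_ge0.
have [h|h] := boolP (0 <= s <= T).
  rewrite indicE mem_setE in_itv/= h mulr1; apply: le_trans (XK _ h).
  by rewrite le_eqVlt; apply/orP; left; apply/eqP; apply: eq_integral => w _;
    rewrite ger0_norm ?sqr_ge0.
rewrite indicE mem_setE in_itv/= (negbTE h) mulr0 integral0_eq// => w _.
by rewrite Xout// expr0n/= ?abse0 ?normr0.
Qed.

(** Meant for [f (0, 0)] and [Z], where the finite quantity is the iterated integral with time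
    inside. *)
Lemma integrable_of_path_L2 (X : R * Omega -> R) (Q : R -> Omega -> R) :
  measurable_fun setT X ->
  (forall s w, ~~ (0 <= s <= T) -> X (s, w) = 0) ->
  (forall s w, 0 <= s <= T -> X (s, w) ^+ 2 <= Q s w) ->
  (\int[P]_w \int[mu]_(s in `[0%R, T]) (Q s w)%:E < +oo)%E ->
  muP.-integrable setT (EFin \o X).
Proof.
move=> mX Xout XQ Qoo; apply: integrable_of_sqr => //.
apply/integrable21ltyP.
  by apply/measurable_EFinP; exact: measurable_funX.
apply: le_lt_trans Qoo.
apply: le_integral_lower => w; first exact: integral_ge0.
rewrite [leRHS]integral_mkcond.
apply: le_integral_lower => s //.
rewrite patchE mem_setE in_itv/=; case: ifPn => h.
  by rewrite /= lee_fin ger0_norm ?sqr_ge0// XQ.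
by rewrite Xout// expr0n/= ?abse0 ?normr0.
Qed.

End integrability.

(** * Processes cut to a time window and off a null set *)

Section windowed.
Context {d : measure_display} {Omega : measurableType d} {R : realType}.
Variables (P : probability Omega R).
Notation mu := (@lebesgue_measure R).
Notation muP := (mu \x P)%E.

Lemma ae_null_set (A : Omega -> Prop) : {ae P, forall w, A w} ->
  exists N : set Omega, [/\ measurable N, P N = 0 & forall w, ~ N w -> A w].
Proof.
move=> [N [mN N0 AN]]; exists N; split => // w Nw.
by apply: contrapT => nA; apply: Nw; exact: AN.
Qed.

Lemma integrable_of_L2 (X : Omega -> R) : measurable_fun setT X ->
  (\int[P]_w (X w ^+ 2)%:E < +oo)%E -> P.-integrable setT (EFin \o X).
Proof.
move=> mX Xoo.
have iX2 : P.-integrable setT (EFin \o (fun w => X w ^+ 2)).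
  apply/integrableP; split; first by apply/measurable_EFinP; exact: measurable_funX.
  apply: le_lt_trans Xoo; rewrite le_eqVlt; apply/orP; left; apply/eqP.
  by apply: eq_integral => w _; rewrite /= ger0_norm ?sqr_ge0.
apply: (integrable_ler measurableT (g := fun w => 1 + X w ^+ 2)) => //.
  move=> w _; rewrite -(real_normK (num_real (X w))).
  by have := sqr_ge0 (`|X w| - 1/2); nra.
by apply: (integrable_addr measurableT) => //; exact: finite_measure_integrable_cst.
Qed.

(* Extending by [0] outside [a, b] and on a null set makes the sections
   integrable for every outcome, not just almost surely. *)
Definition windowed (N : set Omega) (a b : R) (X : R -> Omega -> R) (p : R * Omega) : R :=
  if (a <= p.1 <= b) && (p.2 \notin N) then X p.1 p.2 else 0.

Lemma windowedE N a b X s w : ~ N w -> a <= s <= b -> windowed N a b X (s, w) = X s w.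
Proof. by move=> Nw ab; rewrite /windowed/= ab memNset. Qed.

Lemma windowed_out N a b X s w : ~~ (a <= s <= b) -> windowed N a b X (s, w) = 0.
Proof. by move=> /negbTE ab; rewrite /windowed/= ab. Qed.

Lemma windowed_null (N : set Omega) a b X s w : N w -> windowed N a b X (s, w) = 0.
Proof. by move=> Nw; rewrite /windowed/= mem_set// andbF. Qed.

Lemma measurable_windowed (N : set Omega) a b X : measurable N ->
  measurable_fun ((`[a, b]%classic : set R) `*` ~` N) (fun p : R * Omega => X p.1 p.2) ->
  measurable_fun setT (windowed N a b X).
Proof.
move=> mN mX; have mD : measurable ((`[a, b]%classic : set R) `*` ~` N).
  by apply: measurableX => //; exact: measurableC.
rewrite (_ : windowed N a b X = (fun p => X p.1 p.2) \_ ((`[a, b]%classic : set R) `*` ~` N)).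
  exact: ((measurable_restrictT _ mD).1 mX).
apply/funext => -[s w]; rewrite /windowed patchE /=; congr (if _ then _ else _).
apply/idP/idP; rewrite inE /= in_itv/=.
  by move=> /andP[-> /negP Nw]; split => // wN; apply: Nw; rewrite inE.
by move=> [-> Nw]; rewrite memNset.
Qed.

Lemma measurable_windowed_process (N : set Omega) a b X : measurable N ->
  measurable_process `[a, b] X -> measurable_fun setT (windowed N a b X).
Proof.
move=> mN mX; apply: measurable_windowed => //.
apply: measurable_funS mX; first exact: measurableX.
by move=> p [] ? _.
Qed.

Variables (N N' : set Omega) (a a' b : R).
Hypotheses (mN' : measurable N') (NN' : N `<=` N') (aa' : a <= a').

Lemma windowed_le X p : `|windowed N' a' b X p| <= `|windowed N a b X p|.
Proof.
case: p => s w; rewrite /windowed/=.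
have [/andP[sb /negP Nw]|_] := boolP ((a' <= s <= b) && (w \notin N')); last by rewrite normr0.
have -> : a <= s <= b by move: sb => /andP[h ->]; rewrite (le_trans aa' h).
by rewrite memNset// => /NN' wN; apply: Nw; rewrite inE.
Qed.

Lemma windowed_restrict X p :
  windowed N' a' b X p = \1_((`[a', b]%classic : set R) `*` ~` N') p * windowed N a b X p.
Proof.
case: p => s w; rewrite indicE.
have [h|h] := boolP ((s, w) \in (`[a', b]%classic : set R) `*` ~` N').
  move: h; rewrite inE/= in_itv/= => -[sb Nw].
  rewrite mul1r !windowedE//; first by move=> /NN'.
  by move: sb => /andP[h ->]; rewrite (le_trans aa' h).
rewrite mul0r /windowed/=; case: ifP => // /andP[sb Nw]; move: h.
by rewrite notin_setE/= in_itv/= sb; case; split => // /mem_set; exact/negP.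
Qed.

Lemma measurable_windowed_sub X : measurable_fun setT (windowed N a b X) ->
  measurable_fun setT (windowed N' a' b X).
Proof.
move=> mX; rewrite (funext (windowed_restrict X)).
apply: measurable_funM => //; apply: measurable_indic; apply: measurableX => //.
exact: measurableC.
Qed.

Lemma integrable_windowed_sub X : muP.-integrable setT (EFin \o windowed N a b X) ->
  muP.-integrable setT (EFin \o windowed N' a' b X).
Proof.
move=> iX; apply: (@integrable_ler _ _ _ muP setT measurableT _ (fun p => `|windowed N a b X p|)).
- by apply: measurable_windowed_sub; apply/measurable_EFinP; exact: measurable_int iX.
- by move=> p _; exact: windowed_le.
- exact: (integrable_normr iX).
Qed.

(** On [N'] the section is [0], so integrable paths off [N'] yield integrable paths for every
    outcome. *)
Lemma integrable_windowed_section X w : measurable_fun setT (windowed N a b X) ->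
  (~ N' w -> mu.-integrable setT (fun s => (windowed N a b X (s, w))%:E)) ->
  mu.-integrable setT (EFin \o (fun s => windowed N' a' b X (s, w))).
Proof.
move=> mX iX; have [Nw|Nw] := pselect (N' w).
  rewrite (_ : _ \o _ = cst 0%E); first exact: integrable0.
  by apply/funext => s /=; rewrite windowed_null.
apply: (lebesgue_integrable_ler (g := fun s => `|windowed N a b X (s, w)|)).
- exact: (measurable_fun_pair1 w (measurable_windowed_sub mX)).
- by move=> s; exact: windowed_le.
- exact: (integrable_normr (iX Nw)).
Qed.

End windowed.

(** * From the BSDE to the value of the control problem *)

Section bsde.
Context {R : realType} {d : measure_display} {Omega : measurableType d}.
Variables (P : probability Omega R) (F : R -> set (set Omega)) (n : nat).
Variables (W : R -> Omega -> 'rV[R]_n) (T lambda : R) (xi : Omega -> R).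
Variables (f : R -> Omega -> R -> 'rV[R]_n -> R) (S : R -> Omega -> R).
Variables (Y : R -> Omega -> R) (Z : R -> Omega -> 'rV[R]_n).
Hypotheses (T_gt0 : 0 < T) (lambda_gt0 : 0 < lambda).
Hypotheses (F_usual : usual_filtration P F) (W_brownian : brownian_motion P F W).
Hypothesis data : standing_assumption P F T xi f S.
Hypothesis solution : is_penalized_bsde_solution P F W T lambda xi f S Y Z.
Notation mu := (@lebesgue_measure R).
Notation muP := (mu \x P)%E.

Let T0 : 0 <= T. Proof. exact: ltW. Qed.

Lemma usual_complete : measure_is_complete P.
Proof.
by case: F_usual => _ _ _ F0 N /F0; exact: (filtration_sub F_usual (lexx 0)).
Qed.

Let mSup s w (X : R -> Omega -> R) : 0 <= s <= T ->
  ((X s w ^+ 2)%:E <= ereal_sup [set (`|X t w| ^+ 2)%:E | t in `[0%R, T]])%E.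
Proof.
move=> sT; apply: ereal_sup_ubound; exists s; first by rewrite /= in_itv.
by rewrite real_normK ?num_real.
Qed.

Let Y_process : measurable_process `[0, T] Y. Proof. by case: solution => -[]. Qed.
Let S_process : measurable_process `[0, T] S. Proof. by case: data => _ _ [_ []]. Qed.
Let Z_process i : measurable_process `[0, T] (fun t w => Z t w 0 i).
Proof. by case: solution => _ /(_ i)[]. Qed.
Let Y_adapted s : 0 <= s <= T -> measurable_wrt (F s) (Y s).
Proof. by move=> sT; case: solution => -[_ + _ _ _]; apply; rewrite /= in_itv. Qed.
Let S_adapted s : 0 <= s <= T -> measurable_wrt (F s) (S s).
Proof. by move=> sT; case: data => _ _ [_ [_ +] _]; apply; rewrite /= in_itv. Qed.

Let S_L2 : exists K, forall s, 0 <= s <= T -> (\int[P]_w (S s w ^+ 2)%:E <= K%:E)%E.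
Proof.
have [_ _ [_ _ Soo]] := data.
exists (fine (\int[P]_w ereal_sup [set (`|S t w| ^+ 2)%:E | t in `[0%R, T]])).
have sup0 w : (0 <= ereal_sup [set (`|S t w| ^+ 2)%:E | t in `[0%R, T]])%E.
  by apply: (@le_trans _ _ (S 0 w ^+ 2)%:E); rewrite ?lee_fin ?sqr_ge0// mSup// lexx.
move=> s sT; rewrite fineK.
  by apply: le_integral_lower => w; rewrite ?lee_fin ?sqr_ge0// mSup.
by rewrite ge0_fin_numE//; apply: integral_ge0.
Qed.

Let Y_L2 : exists K, forall s, 0 <= s <= T -> (\int[P]_w (Y s w ^+ 2)%:E <= K%:E)%E.
Proof.
have [_ _ Yoo _] := solution.
set I := (X in (X < +oo)%E) in Yoo.
have sup0 w : (0 <= ereal_sup [set (`|Y t w| ^+ 2)%:E | t in `[0%R, T]])%E.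
  by apply: (@le_trans _ _ (Y 0 w ^+ 2)%:E); rewrite ?lee_fin ?sqr_ge0// mSup// lexx.
exists (fine I) => s sT; rewrite fineK.
  apply: le_integral_lower => w; rewrite ?lee_fin ?sqr_ge0//.
  by rewrite (le_trans (mSup _ _ sT))// leeDl// integral_ge0// => u _; rewrite lee_fin sqr_ge0.
rewrite ge0_fin_numE//; apply: integral_ge0 => w _.
by rewrite adde_ge0// integral_ge0// => u _; rewrite lee_fin sqr_ge0.
Qed.

Let Z_L2 : (\int[P]_w \int[mu]_(s in `[0%R, T]) (eucl (Z s w) ^+ 2)%:E < +oo)%E.
Proof.
have [_ _ Yoo _] := solution; apply: le_lt_trans Yoo.
apply: le_integral_lower => w.
  by rewrite integral_ge0// => u _; rewrite lee_fin sqr_ge0.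
rewrite leeDr//.
by apply: (@le_trans _ _ (Y 0 w ^+ 2)%:E); rewrite ?lee_fin ?sqr_ge0// mSup// lexx.
Qed.

Let xi_integrable : P.-integrable setT (EFin \o xi).
Proof.
have [[mxi xioo] _ _] := data; apply: integrable_of_L2 => //.
exact: (measurable_wrt_measurable (filtration_sub F_usual T0) mxi).
Qed.

Let Y_integrable s : 0 <= s <= T -> P.-integrable setT (EFin \o Y s).
Proof.
move=> /[dup] sT /andP[s0 _]; have [K YK] := Y_L2.
apply: integrable_of_L2 => //.
  by apply: (measurable_wrt_measurable (filtration_sub F_usual s0)); exact: Y_adapted.
exact: le_lt_trans (YK _ sT) (ltry _).
Qed.

Section good_set.
Variables (C : R) (M : R -> Omega -> R) (N : set Omega).
Hypotheses (C0 : 0 < C) (mN : measurable N).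
Hypothesis lipN : forall w, ~ N w -> forall s, 0 <= s <= T -> forall y y' z z',
  `|f s w y z - f s w y' z'| <= C * (`|y - y'| + eucl (z - z')).
Hypothesis ito_M : is_ito_integral P F W T Z M.
Hypothesis bsdeN : forall w, ~ N w -> forall s, 0 <= s <= T ->
  Y s w = xi w + \int[mu]_(u in `[s, T]) f u w (Y u w) (Z u w)
    + \int[mu]_(u in `[s, T]) (lambda * Num.max 0 (S u w - Y u w))
    - (M T w - M s w).

Let fYZ s w := f s w (Y s w) (Z s w).

Let mcutY : measurable_fun setT (windowed N 0 T Y).
Proof. exact: measurable_windowed_process. Qed.
Let mcutS : measurable_fun setT (windowed N 0 T S).
Proof. exact: measurable_windowed_process. Qed.
(** The Lipschitz bound holds only off [N], so the Caratheodory argument is run on the complement of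
    [N]. *)
Let mcutf : measurable_fun setT (windowed N 0 T fYZ).
Proof.
apply: measurable_windowed => //.
have sub : (`[0, T]%classic : set R) `*` ~` N `<=` `[0, T]%classic `*` setT.
  by move=> p [].
have mD : measurable ((`[0, T]%classic : set R) `*` setT : set (R * Omega)).
  exact: measurableX.
have [_ [mf _ _ _] _] := data.
apply: (@measurable_fun_lipschitz_comp _ _ _ n _ (fun p => f p.1 p.2) (fun p => Y p.1 p.2)
  (fun p => Z p.1 p.2) C).
- by apply: measurableX => //; exact: measurableC.
- exact: ltW.
- by move=> a b; exact: measurable_funS mD sub (mf a b).
- move=> [s w] [/= sT Nw] a a' b b'; apply: lipN => //.
- exact: measurable_funS mD sub Y_process.
- by move=> i; exact: measurable_funS mD sub (Z_process i).
Qed.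

Let windowed_unif X K : measurable_fun setT (windowed N 0 T X) ->
  (forall s, 0 <= s <= T -> (\int[P]_w (X s w ^+ 2)%:E <= K%:E)%E) ->
  muP.-integrable setT (EFin \o windowed N 0 T X).
Proof.
move=> mX XK; apply: (@integrable_of_unif_L2 _ _ _ P _ _ K) => //.
- by move=> s w; exact: windowed_out.
- move=> s sT; apply: le_trans (XK s sT); apply: le_integral_lower => w.
    by rewrite lee_fin sqr_ge0.
  by rewrite lee_fin /windowed/=; case: ifP => // _; rewrite expr0n/= sqr_ge0.
Qed.

Let icutY : muP.-integrable setT (EFin \o windowed N 0 T Y).
Proof. by have [K YK] := Y_L2; exact: windowed_unif YK. Qed.
Let icutS : muP.-integrable setT (EFin \o windowed N 0 T S).
Proof. by have [K SK] := S_L2; exact: windowed_unif SK. Qed.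

Let icutf0 : muP.-integrable setT (EFin \o windowed N 0 T (fun s w => f s w 0 0)).
Proof.
have [_ [_ _ [mf0 _] f0oo] _] := data.
apply: (@integrable_of_path_L2 _ _ _ P T _ (fun s w => `|f s w 0 0| ^+ 2)) => //.
- exact: measurable_windowed_process.
- by move=> s w; exact: windowed_out.
- move=> s w _; rewrite real_normK ?num_real//.
  by rewrite /windowed/=; case: ifP => // _; rewrite expr0n/= sqr_ge0.
Qed.

Let icutZ : muP.-integrable setT (EFin \o windowed N 0 T (fun s w => eucl (Z s w))).
Proof.
apply: (@integrable_of_path_L2 _ _ _ P T _ (fun s w => eucl (Z s w) ^+ 2)) => //.
- apply: measurable_windowed_process => //.
  by apply: measurable_eucl => i; exact: Z_process.
- by move=> s w; exact: windowed_out.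
- by move=> s w _; rewrite /windowed/=; case: ifP => // _; rewrite expr0n/= sqr_ge0.
Qed.

(** Off [N], the Lipschitz bound gives [|f (Y, Z)| <= |f (0, 0)| + C (|Y| + |Z|)]. *)
Let icutf : muP.-integrable setT (EFin \o windowed N 0 T fYZ).
Proof.
apply: (@integrable_ler _ _ _ muP setT measurableT _ (fun p =>
  `|windowed N 0 T (fun s w => f s w 0 0) p| +
  C * (`|windowed N 0 T Y p| + `|windowed N 0 T (fun s w => eucl (Z s w)) p|))) => //.
- move=> [s w] _; rewrite /windowed/=; case: ifP => [/andP[sT /negP Nw]|_].
    rewrite [X in C * (_ + X)]ger0_norm ?eucl_ge0//.
    have Nw' : ~ N w by move=> h; apply: Nw; rewrite inE.
    have := lipN Nw' sT (Y s w) 0 (Z s w) 0; rewrite !subr0 => h.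
    rewrite /fYZ -[X in `|X|](subrK (f s w 0 0)) addrC.
    by rewrite (le_trans (ler_normD _ _))// lerD2l.
  by rewrite !normr0 !add0r mulr0.
- apply: (@integrable_addr _ _ _ muP setT measurableT); first exact: (integrable_normr icutf0).
  apply: (@integrable_scaler _ _ _ muP setT measurableT).
  apply: (@integrable_addr _ _ _ muP setT measurableT); first exact: (integrable_normr icutY).
  exact: (integrable_normr icutZ).
Qed.

Hypothesis PN0 : P N = 0.

(** Fubini makes paths integrable only almost surely. Adding the exceptional outcomes to [N] gives
    one null set, common to all times and controls, off which the pathwise decomposition holds. *)
Lemma exists_integrable_sections : exists N' : set Omega,
  [/\ measurable N', P N' = 0, N `<=` N' &
    forall w, ~ N' w -> [/\
      mu.-integrable setT (fun s => (windowed N 0 T fYZ (s, w))%:E),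
      mu.-integrable setT (fun s => (windowed N 0 T Y (s, w))%:E) &
      mu.-integrable setT (fun s => (windowed N 0 T S (s, w))%:E)]].
Proof.
have aeN : {ae P, forall w, ~ N w} by exists N; split => // w /contrapT.
have aef := ae_integrable2 icutf.
have aeY := ae_integrable2 icutY.
have aeS := ae_integrable2 icutS.
have [N' [mN' N'0 h]] := ae_null_set (filterI aeN (filterI aef (filterI aeY aeS))).
exists N'; split => // w; last by move=> /h[_ [? []]].
by move=> Nw; apply: contrapT => /h[].
Qed.

Section control.
Variables (N' : set Omega) (t : R) (r : R -> Omega -> R).
Hypotheses (mN' : measurable N') (PN'0 : P N' = 0) (NN' : N `<=` N').
Hypothesis sections : forall w, ~ N' w -> [/\
      mu.-integrable setT (fun s => (windowed N 0 T fYZ (s, w))%:E),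
      mu.-integrable setT (fun s => (windowed N 0 T Y (s, w))%:E) &
      mu.-integrable setT (fun s => (windowed N 0 T S (s, w))%:E)].
Hypotheses (t0T : 0 <= t <= T) (rc : controls F lambda t r).

Let t0 : 0 <= t. Proof. by case/andP: t0T. Qed.
Let tT : t <= T. Proof. by case/andP: t0T. Qed.

(** Cut in time only: on [[t, T]] the event [r_s = lambda] of [F s] is left as it is. *)
Let rt := windowed set0 t T r.
Let phi := windowed N' t T fYZ.
Let y := windowed N' t T Y.
Let st := windowed N' t T S.

Let rtE s w : t <= s <= T -> rt (s, w) = r s w.
Proof. by move=> ts; rewrite /rt windowedE. Qed.

Let mrt : measurable_fun setT rt.
Proof.
apply: measurable_windowed_process => //; have [[mr _] _] := rc.
apply: measurable_funS mr; first exact: measurableX.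
by move=> [s w] [/=]; rewrite !in_itv/= => /andP[-> _] _.
Qed.

Let rt0l s w : rt (s, w) = 0 \/ rt (s, w) = lambda.
Proof.
have [ts|ts] := boolP (t <= s <= T); last by left; exact: windowed_out.
by rewrite rtE//; have [_ h] := rc; apply: h; case/andP: ts.
Qed.

Let rtF s : t <= s <= T -> F s [set w | rt (s, w) = lambda].
Proof.
move=> /[dup] ts /andP[ts1 _]; have [[_ ar] _] := rc.
have := ar s _ [set lambda] (measurable_set1 lambda).
rewrite /= in_itv/= ts1 => /(_ isT); congr (F s _).
by apply/seteqP; split => w /=; rewrite rtE.
Qed.

Let iphi : muP.-integrable setT (EFin \o phi).
Proof. exact: (integrable_windowed_sub (N := N) (a := 0)). Qed.
Let iy : muP.-integrable setT (EFin \o y).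
Proof. exact: (integrable_windowed_sub (N := N) (a := 0)). Qed.
Let ist : muP.-integrable setT (EFin \o st).
Proof. exact: (integrable_windowed_sub (N := N) (a := 0)). Qed.
Let iphi_w w : mu.-integrable setT (EFin \o (fun u => phi (u, w))).
Proof. by apply: (integrable_windowed_section mN' NN' t0) => // /sections[]. Qed.
Let iy_w w : mu.-integrable setT (EFin \o (fun u => y (u, w))).
Proof. by apply: (integrable_windowed_section mN' NN' t0) => // /sections[]. Qed.
Let ist_w w : mu.-integrable setT (EFin \o (fun u => st (u, w))).
Proof. by apply: (integrable_windowed_section mN' NN' t0) => // /sections[]. Qed.

Let D s w := remainder lambda (fun u => phi (u, w)) (fun u => y (u, w))
  (fun u => st (u, w)) (xi w) s.

(** The BSDE solved for the martingale increment; merging its two time integrals into one uses the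
    integrability of the path, granted by [sections]. *)
Let D_eq s w : ~ N' w -> t <= s <= T -> M T w - M s w = D s w.
Proof.
move=> Nw /[dup] ts /andP[ts1 sT].
have Nw0 : ~ N w by move=> /NN'.
have s0T : 0 <= s <= T by rewrite sT (le_trans t0 ts1).
have imax : mu.-integrable setT (EFin \o (fun u => lambda * Num.max 0 (st (u, w) - y (u, w)))).
  apply: (@integrable_scaler _ _ (measurableTypeR R) mu setT measurableT).
  apply: (lebesgue_integrable_ler (g := fun u => `|st (u, w) - y (u, w)|)).
  - apply: measurable_maxr => //; apply: measurable_funB.
      exact: integrable_measr (ist_w w).
    exact: integrable_measr (iy_w w).
  - move=> u; rewrite ger0_norm ?le_max ?lexx//.
    by rewrite ge_max normr_ge0 ler_norm.
  - exact: (integrable_normr (integrable_subr measurableT (ist_w w) (iy_w w))).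
have icut (g : R -> R) : mu.-integrable setT (EFin \o g) ->
    mu.-integrable setT (EFin \o (fun u : R => if s <= u then g u else 0)).
  move=> ig; apply: (lebesgue_integrable_ler (g := fun u => `|g u|)).
  - apply: measurable_fun_ifT => //; first by apply: measurable_fun_ler.
    exact: integrable_measr ig.
  - by move=> u; case: ifP => // _; rewrite normr0.
  - exact: (integrable_normr ig).
have E1 : \int[mu]_(u in `[s, T]) f u w (Y u w) (Z u w) =
    \int[mu]_u (if s <= u then phi (u, w) else 0).
  rewrite Rintegral_mkcond; apply: eq_Rintegral => u _; rewrite patchE mem_setE in_itv/=.
  have [su|su] := boolP (s <= u <= T).
    by move: su => /andP[su uT]; rewrite su /phi windowedE// (le_trans ts1 su).
  case: ifP => // su'; rewrite /phi windowed_out//.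
  by move: su; rewrite su' /= => /negbTE ->; rewrite andbF.
have E2 : \int[mu]_(u in `[s, T]) (lambda * Num.max 0 (S u w - Y u w)) =
    \int[mu]_u (if s <= u then lambda * Num.max 0 (st (u, w) - y (u, w)) else 0).
  rewrite Rintegral_mkcond; apply: eq_Rintegral => u _; rewrite patchE mem_setE in_itv/=.
  have [su|su] := boolP (s <= u <= T).
    by move: su => /andP[su uT]; rewrite su /st /y !windowedE// (le_trans ts1 su).
  case: ifP => // su'; have out : ~~ (t <= u <= T).
    by move: su; rewrite su' /= => /negbTE ->; rewrite andbF.
  by rewrite /st /y !windowed_out// subrr maxxx mulr0.
rewrite /D /remainder {1}/y windowedE// (bsdeN Nw0 s0T) E1 E2.
have -> : \int[mu]_u (if s <= u then phi (u, w) + lambda * Num.max 0 (st (u, w) - y (u, w))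
      else 0) =
    \int[mu]_u (if s <= u then phi (u, w) else 0) +
    \int[mu]_u (if s <= u then lambda * Num.max 0 (st (u, w) - y (u, w)) else 0).
  rewrite -RintegralD//; [|exact: (icut (fun u => phi (u, w)))|exact: icut imax].
  by apply: eq_Rintegral => u _; case: ifP => // _; rewrite addr0.
ring.
Qed.

Let aeN' : {ae P, forall w, ~ N' w}.
Proof. by exists N'; split => // w /contrapT. Qed.

Let oD s : t <= s <= T -> orth P (F s) (D s).
Proof.
move=> /[dup] ts /andP[ts1 sT]; have s0 : 0 <= s by exact: le_trans t0 ts1.
apply: (@orth_ae _ _ _ P _ (fun w => M T w - M s w)).
- exact: usual_complete.
- exact: (filtration_sub F_usual s0).
- by apply: filterS aeN' => w Nw; exact: D_eq.
- by apply: (ito_increment_orth F_usual W_brownian T0 ito_M); rewrite s0.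
Qed.

Let B := gain lambda rt y st.

Let cumulated_eq w s : t <= s <= T ->
  \int[mu]_(u in `[t, s]) r u w = cumulated (fun u => rt (u, w)) s.
Proof.
move=> /andP[ts sT]; rewrite /cumulated Rintegral_mkcond; apply: eq_Rintegral => u _.
rewrite patchE mem_setE in_itv/=; have [us|us] := leP u s; last by rewrite andbF.
rewrite andbT /rt /windowed/= (le_trans us sT) andbT in_set0/= andbT.
by [].
Qed.

Let N_ w := D t w - \int[mu]_s (killing (fun u => rt (u, w)) s * D s w).

Let payoff_eq w : ~ N' w -> payoff T xi f S Y Z t r w = Y t w + N_ w + B w.
Proof.
move=> Nw; have tt : t <= t <= T by rewrite lexx.
have TT : t <= T <= T by rewrite lexx andbT.
have h : \int[mu]_s ((phi (s, w) + rt (s, w) * st (s, w)) *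
      expR (- cumulated (fun u => rt (u, w)) s)) +
    expR (- cumulated (fun u => rt (u, w)) T) * xi w = y (t, w) + N_ w + B w.
  apply: (payoff_decomposition_gain lambda_gt0 xi mrt rt0l) => //; by move=> ? ?; exact: windowed_out.
have yt : y (t, w) = Y t w by rewrite /y windowedE.
have E1 : \int[mu]_(s in `[t, T]) ((f s w (Y s w) (Z s w) + r s w * S s w) *
      expR (- \int[mu]_(u in `[t, s]) r u w)) =
    \int[mu]_s ((phi (s, w) + rt (s, w) * st (s, w)) *
      expR (- cumulated (fun u => rt (u, w)) s)).
  rewrite Rintegral_mkcond; apply: eq_Rintegral => s _.
  rewrite patchE mem_setE in_itv/=; case: ifPn => ts.
    have -> : phi (s, w) = f s w (Y s w) (Z s w) by exact: windowedE.
    have -> : st (s, w) = S s w by exact: windowedE.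
    by rewrite rtE// (cumulated_eq w ts).
  have -> : phi (s, w) = 0 by exact: windowed_out.
  have -> : rt (s, w) = 0 by exact: windowed_out.
  by rewrite mul0r addr0 mul0r.
have E2 := cumulated_eq w TT.
exact: (etrans (congr2 +%R E1 (congr1 (fun x => expR (- x) * xi w) E2))
  (etrans h (congr1 (fun x => x + N_ w + B w) yt))).
Qed.

Let oN : orth P (F t) N_.
Proof.
apply: (orth_killed_remainder F_usual t0 tT lambda_gt0 mrt rt0l rtF) => //; exact: windowed_out.
Qed.

Let iB : P.-integrable setT (EFin \o B).
Proof. exact: (integrable_gain lambda_gt0 mrt rt0l). Qed.

Let B_le0 w : B w <= 0.
Proof. exact: (gain_nonpos lambda_gt0 mrt rt0l). Qed.

Let iYt : P.-integrable setT (EFin \o Y t). Proof. exact: Y_integrable. Qed.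

Let payoff_ae : {ae P, forall w, Y t w + N_ w + B w = payoff T xi f S Y Z t r w}.
Proof. by apply: filterS aeN' => w /payoff_eq ->. Qed.

Let isum : P.-integrable setT (EFin \o (fun w => Y t w + N_ w + B w)).
Proof.
apply: (integrable_addr measurableT) => //.
by apply: (integrable_addr measurableT) => //; exact: oN.1.
Qed.

Let ipayoff : P.-integrable setT (EFin \o payoff T xi f S Y Z t r).
Proof. exact: integrable_ae_eq usual_complete payoff_ae isum. Qed.

Let tM := filtration_sub F_usual t0.

(** The centred term [N_] integrates to zero over every event of [F t]. *)
Let integral_payoff A : F t A ->
  (\int[P]_(w in A) (payoff T xi f S Y Z t r w)%:E =
   \int[P]_(w in A) (Y t w + B w)%:E)%E.
Proof.
move=> FA; have mA := tM FA.
have sub X : P.-integrable setT (EFin \o X) -> P.-integrable A (EFin \o X).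
  exact: integrableS.
rewrite -(integral_ae_eq_sub mA payoff_ae)//.
have iYB : P.-integrable setT (EFin \o (fun w => Y t w + B w)).
  exact: (integrable_addr measurableT).
transitivity (\int[P]_(w in A) ((Y t w + B w)%:E + (N_ w)%:E))%E.
  by apply: eq_integral => w _; rewrite -EFinD addrAC.
rewrite integralD//; [by rewrite oN.2// adde0|exact: sub iYB|exact: sub oN.1].
Qed.

Let V := condE P (F t) (payoff T xi f S Y Z t r).

(** [condE] is a choice with default [0]; the existence of a version gives access to its defining
    properties. *)
Let V_condE : is_condE P (F t) (payoff T xi f S Y Z t r) V.
Proof.
have := condE_exists tM (filtration_sa F_usual t0) ipayoff.
exact: (@xgetPex _ (cst 0) [set V | is_condE P (F t) (payoff T xi f S Y Z t r) V]).
Qed.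

Let condE_payoff_le_control : {ae P, forall w, V w <= Y t w}.
Proof.
have [_ iV mV VE] := V_condE.
apply: (condE_le_ae tM (filtration_sa F_usual t0)) => //; first exact: Y_adapted.
move=> A FA; rewrite VE// integral_payoff//; have mA := tM FA.
apply: le_integral => //.
- by apply: (integrableS measurableT) => //; exact: (integrable_addr measurableT).
- exact: (integrableS measurableT).
- by move=> w _; rewrite lee_fin gerDl.
Qed.

Let condE_payoff_ge_control :
  (forall s w, t <= s <= T -> r s w = optimal_control T lambda S Y s w) ->
  {ae P, forall w, Y t w <= V w}.
Proof.
move=> ropt; have [_ iV mV VE] := V_condE.
(* For this control [r (st - y) = lambda max (0, st - y)] everywhere: outside the window and on [N']
   both sides are [0], since [st] and [y] vanish there. *)
have B0 w : B w = 0.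
  apply: gain_optimal => s; have [ts|ts] := boolP (t <= s <= T); last first.
    by rewrite /st /y !windowed_out// subrr mulr0 maxxx mulr0.
  have [Nw|Nw] := pselect (N' w).
    by rewrite /st /y !windowed_null// subrr mulr0 maxxx mulr0.
  rewrite rtE// ropt// /optimal_control /st /y !windowedE//.
  case/andP: ts => _ -> /=; have [YS|SY] := leP (Y s w) (S s w).
    by rewrite mulr1 max_r// subr_ge0.
  by rewrite mulr0 mul0r max_l ?mulr0// subr_le0 ltW.
apply: (condE_le_ae tM (filtration_sa F_usual t0)) => //; first exact: Y_adapted.
move=> A FA; rewrite VE// integral_payoff//.
by under [leRHS]eq_integral do rewrite B0 addr0.
Qed.

Lemma condE_payoff_bounds : {ae P, forall w, V w <= Y t w} /\
  ((forall s w, t <= s <= T -> r s w = optimal_control T lambda S Y s w) ->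
   {ae P, forall w, Y t w <= V w}).
Proof. by split. Qed.

End control.
End good_set.

(** One null set serves for both the Lipschitz bound and the equation, each of which holds almost
    surely for all times at once. *)
Lemma condE_payoff t r : 0 <= t <= T -> controls F lambda t r ->
  {ae P, forall w, condE P (F t) (payoff T xi f S Y Z t r) w <= Y t w} /\
  ((forall s w, t <= s <= T -> r s w = optimal_control T lambda S Y s w) ->
   {ae P, forall w, Y t w <= condE P (F t) (payoff T xi f S Y Z t r) w}).
Proof.
move=> t0T rc.
have [_ [_ [C C0 lip] _ _] _] := data.
have [_ _ _ [M ito_M bsde]] := solution.
have [N [mN PN0 h]] := ae_null_set (filterI lip bsde).
have lipN w (Nw : ~ N w) := (h w Nw).1; have bsdeN w (Nw : ~ N w) := (h w Nw).2.
have [N' [mN' PN'0 NN' sec]] := exists_integrable_sections C0 mN lipN PN0.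
exact: (condE_payoff_bounds C0 mN lipN ito_M bsdeN mN' PN'0 NN' sec t0T rc).
Qed.

Lemma optimal_control_is_control t : 0 <= t <= T ->
  controls F lambda t (optimal_control T lambda S Y).
Proof.
move=> /andP[t0 tT]; split; last first.
  move=> s w _; rewrite /optimal_control; case: (_ && _).
    by right; rewrite mulr1.
  by left; rewrite mulr0.
have optE (s : R) (w : Omega) : s <= T ->
    optimal_control T lambda S Y s w = lambda * ((Y s w <= S s w)%R)%:R.
  by rewrite /optimal_control => ->.
split.
- pose D := (`[0, T]%classic : set R) `*` [set: Omega].
  (* The constraint [s <= T] is built into [A], so [lambda * \1_A] agrees with the control on all of
     [[t, +oo[]. *)
  pose A := D `&` [set p : R * Omega | Y p.1 p.2 <= S p.1 p.2].
  have mD : measurable D by exact: measurableX.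
  have mA : measurable A.
    have mY : measurable_fun D (fun p : R * Omega => Y p.1 p.2) by exact: Y_process.
    have mS : measurable_fun D (fun p : R * Omega => S p.1 p.2) by exact: S_process.
    have := measurable_fun_ler mY mS mD (_ : measurable [set true]) => /(_ I).
    by congr (measurable (_ `&` _)); apply/seteqP; split.
  rewrite /measurable_process.
  apply: (eq_measurable_fun (fun p => lambda * \1_A p)) => [[s w]|].
    rewrite inE/= => -[/=]; rewrite in_itv/= andbT => ts _.
    rewrite /optimal_control indicE; congr (_ * (nat_of_bool _)%:R).
    apply/idP/idP; rewrite inE /A /D/= in_itv/=.
      by move=> [[/andP[_ ->] _] ->].
    by move=> /andP[-> ->]; rewrite (le_trans t0 ts).
  by apply: measurable_funTS; apply: measurable_funM => //; exact: measurable_indic.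
- move=> s /=; rewrite in_itv/= andbT => ts; have s0 := le_trans t0 ts.
  apply/(measurable_wrtP (filtration_sa F_usual s0)).
  have [sT|sT] := leP s T; last first.
    rewrite (_ : optimal_control _ _ _ _ s = cst 0); first exact: measurable_cst.
    by apply/funext => w; rewrite /optimal_control leNgt sT/= mulr0.
  rewrite (_ : optimal_control _ _ _ _ s =
    (fun w => if Y s w <= S s w then lambda else 0)); last first.
    by apply/funext => w; rewrite optE//; case: (Y s w <= S s w); rewrite ?mulr1 ?mulr0.
  have sT' : 0 <= s <= T by rewrite s0.
  apply: measurable_fun_ifT => //; apply: measurable_fun_ler.
    by apply/(measurable_wrtP (filtration_sa F_usual s0)); exact: Y_adapted.
  by apply/(measurable_wrtP (filtration_sa F_usual s0)); exact: S_adapted.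
Qed.

(** Every control yields at most [Y t]; any other upper bound dominates the conditional payoff of
    the optimal control, which already reaches [Y t]. *)
Lemma Y_is_ess_sup t : 0 <= t <= T ->
  is_ess_sup_family P (controls F lambda t) (conditional_payoff P F T xi f S Y Z t)
    (EFin \o Y t).
Proof.
move=> /[dup] t0T /andP[t0 tT]; have oc := optimal_control_is_control t0T.
split.
- apply/measurable_EFinP.
  exact: (measurable_wrt_measurable (filtration_sub F_usual t0) (Y_adapted t0T)).
- move=> r rc; have [le _] := condE_payoff t0T rc.
  by apply: filterS le => w; rewrite lee_fin.
- move=> V' _ /(_ _ oc) V'le; have [_ /(_ (fun _ _ _ => erefl)) ge] := condE_payoff t0T oc.
  apply: filterS2 ge V'le => w Yw; apply: le_trans; rewrite lee_fin//.
Qed.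

End bsde.

Theorem proposition4p1 (R : realType) (d : measure_display)
    (Omega : measurableType d) (P : probability Omega R)
    (F : R -> set (set Omega)) (n : nat) (W : R -> Omega -> 'rV[R]_n)
    (T lambda : R) (xi : Omega -> R) (f : R -> Omega -> R -> 'rV[R]_n -> R)
    (S : R -> Omega -> R) (Y : R -> Omega -> R) (Z : R -> Omega -> 'rV[R]_n)
    (T_gt0 : 0 < T) (lambda_gt0 : 0 < lambda)
    (F_usual : usual_filtration P F) (W_brownian : brownian_motion P F W)
    (data : standing_assumption P F T xi f S)
    (solution : is_penalized_bsde_solution P F W T lambda xi f S Y Z) :
  forall t : R, 0 <= t <= T ->
    [/\ is_ess_sup_family P (controls F lambda t)
          (conditional_payoff P F T xi f S Y Z t)
          (value P F T lambda xi f S Y Z t),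
        {ae P, forall w, value P F T lambda xi f S Y Z t w = (Y t w)%:E}
      & is_optimal P F T lambda xi f S Y Z t (optimal_control T lambda S Y)].
Proof.
move=> t t0T.
have Ysup := Y_is_ess_sup T_gt0 lambda_gt0 F_usual W_brownian data solution t0T.
have vsup : is_ess_sup_family P (controls F lambda t)
    (conditional_payoff P F T xi f S Y Z t) (value P F T lambda xi f S Y Z t).
  (* [value] is a choice among essential suprema; [Y t] witnesses that there is one. *)
  exact: (@xgetPex _ (cst 0%E) _ (ex_intro _ _ Ysup)).
have vY : {ae P, forall w, value P F T lambda xi f S Y Z t w = (Y t w)%:E}.
  have [mY Yub Ylub] := Ysup; have [mv vub vlub] := vsup.
  (* Two essential suprema of the same family dominate each other almost surely. *)
  by apply: filterS2 (vlub _ mY Yub) (Ylub _ mv vub) => w h1 h2; apply/le_anti; rewrite h1 h2.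
have oc := optimal_control_is_control F_usual data solution t0T.
have [le /(_ (fun _ _ _ => erefl)) ge] :=
  condE_payoff T_gt0 lambda_gt0 F_usual W_brownian data solution t0T oc.
split => //; split => //.
apply: filterS3 vY le ge => w -> h1 h2.
by rewrite /conditional_payoff/=; congr EFin; apply/le_anti; rewrite h1 h2.
Qed.
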